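(* Let $\mathcal{M}\subseteq\mathbb{R}^{m\times n}$ be an embedded Riemannian manifold and let $\Phi(\Theta)=-\mathbb{E}_{P_x}\big[\mathbb{E}_{P_{y|x}(\Theta)}\log p(y|f(x,\Theta))\big]$. Then for any second-order retraction $R$ on $\mathcal{M}$, the steepest descent direction in the tangent space to $\mathcal{M}$ at $\Theta$ (with vectorization $\theta$) is given by $-d^R(\theta)$, where $d^R(\theta)=(F^R(\theta))^{-1}\,\mathrm{grad}\,\Phi(\theta)$, in the sense that $$\frac{-d^R(\theta)}{\|\mathrm{grad}\,\Phi(\theta)\|_{(F^R(\theta))^{-1}}}=\lim_{\epsilon\to 0}\frac1\epsilon\ \operatorname*{arg\,min}_{d\in T_\theta\mathcal{M}:\ \mathbb{E}_{P_x}\left[\mathrm{KL}\left(P_{y|x}(R_\theta(d))\,\|\,P_{y|x}(\theta)\right)\right]\le \epsilon^2/2}\ \Phi(R_\theta(d)),$$ where $\|\mathrm{grad}\,\Phi(\theta)\|_{(F^R(\theta))^{-1}}=\sqrt{\mathrm{grad}\,\Phi(\theta)^\top (F^R(\theta))^{-1}\,\mathrm{grad}\,\Phi(\theta)}$.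
   Context: Matrices $\Theta\in\mathbb{R}^{m\times n}$ are identified with their vectorizations $\theta=\mathrm{vec}(\Theta)\in\mathbb{R}^{r}$, $r=mn$; $T_\theta\mathcal{M}$ is the tangent space at $\Theta$, viewed (by vectorization) as a subspace of $\mathbb{R}^r$, and $\mathcal{M}$ carries the metric induced from the Euclidean inner product. $\mathrm{grad}$ denotes the Riemannian gradient (orthogonal projection of the Euclidean gradient onto $T_\theta\mathcal{M}$), with respect to $\theta$. Statistical model: $f(\cdot,\Theta):\mathcal{X}\to\mathcal{Y}$ is a parametrized map from the input space to the output space; $p(y|z)$ is a conditional density; $P_{y|x}(\Theta):=P_{y|f(x,\Theta)}$ is the distribution of $y$ with density $p(\cdot|f(x,\Theta))$; $P_x$ is a distribution on $\mathcal{X}$. Regularity conditions allowing expectation and differentiation with respect to the parameter to be interchanged are assumed throughout. $\mathrm{KL}(\cdot\|\cdot)$ is the Kullback–Leibler divergence. Riemannian Fisher information matrix: $$F^R(\theta):=\mathbb{E}_{P_x}\Big[\mathbb{E}_{P_{y|x}(\theta)}\big[\mathrm{grad}\log p(y|f(x,\theta))\ \mathrm{grad}\log p(y|f(x,\theta))^\top\big]\Big]\in\mathbb{R}^{r\times r}.$$ $F^R(\theta)$ is regarded as a linear operator $T_\theta\mathcal{M}\to T_\theta\mathcal{M}$, assumed positive definite there, and $(F^R(\theta))^{-1}$ denotes its inverse on $T_\theta\mathcal{M}$. A retraction is a smooth map $R:T\mathcal{M}=\bigcup_\Theta T_\Theta\mathcal{M}\to\mathcal{M}$ with $R_\Theta(0)=\Theta$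 and $\frac{d}{dt}R_\Theta(t\xi)|_{t=0}=\xi$ for all $\xi\in T_\Theta\mathcal{M}$. It is a second-order retraction if moreover $\mathcal{P}_{T_\Theta\mathcal{M}}\big(\frac{d^2}{dt^2}R_\Theta(t\xi)|_{t=0}\big)=0$ for all $\Theta\in\mathcal{M}$, $\xi\in T_\Theta\mathcal{M}$, where $\mathcal{P}_{T_\Theta\mathcal{M}}$ is the orthogonal projection onto $T_\Theta\mathcal{M}$.
   Formalization: The argmin over all of the tangent space can fail (exponential map of a circle); the limit is proved for the argmin over small neighbourhoods of 0, and for the full argmin when the feasible sets shrink to 0; ε→0 is from the right, grad Φ is assumed nonzero, and densities positive near Θ. *)

(* Defs.v *)
From HB Require Import structures.
From mathcomp Require Export all_boot all_order all_algebra.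
From mathcomp Require Export all_classical all_reals all_analysis.
Export Order.TTheory GRing.Theory Num.Theory.
Export numFieldNormedType.Exports.

Set Implicit Arguments.
Unset Strict Implicit.
Unset Printing Implicit Defensive.

Local Open Scope classical_set_scope.
Local Open Scope ring_scope.

Section Smooth.
Variables (R : realType) (V W : normedModType R).

(* C^k on an open set U of a finite-dimensional space: all iterated
   directional derivatives up to order k exist and are continuous on U. *)
Fixpoint Ck_on (k : nat) (U : set V) (f : V -> W) : Prop :=
  match k with
  | 0 => forall x, U x -> {for x, continuous f}
  | k'.+1 => (forall x, U x -> differentiable f x) /\
             forall v, Ck_on k' U ('D_v f)
  end.

Definition smooth_on (U : set V) (f : V -> W) : Prop :=
  forall k, Ck_on k U f.

(* Smoothness on a subset A that need not be open: near each point of A, f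
   agrees on A with a smooth function defined on an open set. *)
Definition smooth_on_subset (A : set V) (f : V -> W) : Prop :=
  forall x, A x -> exists (U : set V) (g : V -> W),
    [/\ open U, U x, smooth_on U g & forall y, U y -> A y -> g y = f y].

End Smooth.

Section Manifold.
Variables (R : realType) (m n : nat).
Local Notation E := 'M[R]_(m, n).
Implicit Types (M : set E) (Theta xi : E) (Rt : E -> E -> E).

(* mxvec is row-major; every notion below is invariant under a reordering of
   the m * n coordinates. *)
Definition vec (A : E) : 'cV[R]_(m * n) := (mxvec A)^T.

Definition inner (A B : E) : R := ((vec A)^T *m vec B) 0 0.

(* M is a d-dimensional embedded submanifold (local slice condition): around
   each point of M some diffeomorphism psi : U -> V (with inverse phi) between
   open sets of the ambient space carries M into a d-dimensional subspace. *)
Definition embedded_submanifold (d : nat) M : Prop :=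
  forall Theta, M Theta ->
  exists (U V : set E) (psi phi : E -> E) (S : {vspace E}),
    [/\ open U, U Theta & open V] /\
    [/\ smooth_on U psi,
        smooth_on V phi,
        forall x, U x -> V (psi x) /\ phi (psi x) = x &
        forall y, V y -> U (phi y) /\ psi (phi y) = y] /\
    \dim S = d /\ (forall x, U x -> (M x <-> psi x \in S)).

(* Velocities at Theta of smooth curves in M. *)
Definition tangent M Theta : set E :=
  [set xi | exists (e : R) (c : R -> E),
    [/\ 0 < e, smooth_on (ball (0 : R) e) c,
        forall t, ball (0 : R) e t -> M (c t),
        c 0 = Theta & 'D_1 c (0 : R) = xi]].

Definition tangent_bundle M : set (E * E) :=
  [set z | M z.1 /\ tangent M z.1 z.2].

Definition orth_proj (T : set E) (A : E) : E :=
  xget 0 [set B | T B /\ forall C, T C -> inner (A - B) C = 0].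

Definition egrad (phi : E -> R) Theta : E :=
  \matrix_(i, j) 'D_(delta_mx i j) phi Theta.

Definition rgrad M (phi : E -> R) Theta : E :=
  orth_proj (tangent M Theta) (egrad phi Theta).

(* The inverse, on the subspace T, of the operator A |-> F *m vec A. *)
Definition inv_on (T : set E) (F : 'M[R]_(m * n)) (A : E) : E :=
  xget 0 [set B | T B /\ F *m vec B = vec A].

Definition posdef_on (T : set E) (F : 'M[R]_(m * n)) : Prop :=
  forall A, T A -> A != 0 -> 0 < ((vec A)^T *m F *m vec A) 0 0.

Definition retraction M Rt : Prop :=
  [/\ smooth_on_subset (tangent_bundle M) (fun z => Rt z.1 z.2),
      forall Theta xi, M Theta -> tangent M Theta xi -> M (Rt Theta xi),
      forall Theta, M Theta -> Rt Theta 0 = Theta &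
      forall Theta xi, M Theta -> tangent M Theta xi ->
        is_derive (0 : R) 1 (fun t : R => Rt Theta (t *: xi)) xi].

Definition second_order_retraction M Rt : Prop :=
  retraction M Rt /\
  forall Theta xi, M Theta -> tangent M Theta xi ->
    orth_proj (tangent M Theta)
      ('D_1 ('D_1 (fun t : R => Rt Theta (t *: xi))) (0 : R)) = 0.

End Manifold.

Section Interchange.
Variables (R : realType) (V : normedModType R).
Variables (d : measure_display) (T : measurableType d).
Variable nu : {measure set T -> \bar R}.

(* The derivatives, with respect to the parameter v in U, of the integral of
   g v exist up to order k, are continuous, and are the integrals of the
   derivatives of g. *)
Fixpoint interchange (k : nat) (U : set V) (g : V -> T -> R) : Prop :=
  let Ig v := \int[nu]_w g v w in
  (forall v, U v -> nu.-integrable setT (fun w => (g v w)%:E)) /\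
  (forall v, U v -> {for v, continuous Ig}) /\
  match k with
  | 0 => True
  | k'.+1 =>
      (forall v, U v -> differentiable Ig v) /\
      (forall v w, U v -> differentiable (g ^~ w) v) /\
      forall u,
        (forall v, U v -> 'D_u Ig v = \int[nu]_w 'D_u (g ^~ w) v) /\
        interchange k' U (fun v w => 'D_u (g ^~ w) v)
  end.

End Interchange.

Section Model.
Variables (R : realType) (m n : nat).
Variables (dX dY : measure_display).
Variables (X : measurableType dX) (Y : measurableType dY).
Local Notation E := 'M[R]_(m, n).
Variables (Px : probability X R) (mu : {sigma_finite_measure set Y -> \bar R}).
(* p y z stands for p(y|z), and P z for the distribution P_{y|z}. *)
Variables (p : Y -> Y -> R) (P : Y -> probability Y R) (f : X -> E -> Y).
Variables (M : set E).
Implicit Types (Theta : E).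

Definition conditional_density : Prop :=
  forall z, [/\ forall y, 0 <= p y z,
                measurable_fun setT (p ^~ z) &
                forall A, measurable A -> P z A = (\int[mu]_(y in A) (p y z)%:E)%E].

Definition loglik (x : X) (y : Y) Theta : R := ln (p y (f x Theta)).

Definition Phi Theta : R :=
  - \int[Px]_x \int[P (f x Theta)]_y loglik x y Theta.

Definition fisher Theta : 'M[R]_(m * n) :=
  \matrix_(i, j) \int[Px]_x \int[P (f x Theta)]_y
    (vec (rgrad M (loglik x y) Theta) *m (vec (rgrad M (loglik x y) Theta))^T) i j.

(* KL(P_{y|z1} || P_{y|z2}), with the conventions 0 log (0 / b) = 0 and
   a log (a / 0) = +oo for a > 0. *)
Definition KL (z1 z2 : Y) : \bar R :=
  (\int[mu]_y
     (if p y z1 == 0%R then 0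
      else if p y z2 == 0%R then +oo
      else (p y z1 * ln (p y z1 / p y z2))%:E))%E.

Definition mean_KL Theta1 Theta2 : \bar R :=
  (\int[Px]_x KL (f x Theta1) (f x Theta2))%E.

(* Since E_{P_x} E_{P_{y|x}(Theta')} h is the integral of h * q against
   P_x (x) mu, where q = p(y|f(x,Theta')), the expectations differentiated in
   the parameter Theta' are those whose integrands are listed here: the total
   mass, the divergence from Theta, and Phi. *)
Definition regular_model Theta : Prop :=
  let q Theta' (w : X * Y) := p w.2 (f w.1 Theta') in
  let nu := (Px \x mu)%E in
  exists U : set E,
    [/\ open U, U Theta & forall Theta' w, U Theta' -> 0 < q Theta' w] /\
    [/\ interchange nu 2 U q,
        interchange nu 2 U
          (fun Theta' w => q Theta' w * (ln (q Theta' w) - ln (q Theta w))) &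
        interchange nu 1 U (fun Theta' w => q Theta' w * ln (q Theta' w))].

(* N restricts the candidate directions; N = setT is no restriction. *)
Definition feasible (Rt : E -> E -> E) Theta (N : set E) (e : R) : set E :=
  [set d | [/\ N d, tangent M Theta d &
               (mean_KL (Rt Theta d) Theta <= (e ^+ 2 / 2)%:E)%E]].

Definition argmin (D : set E) (phi : E -> R) : set E :=
  [set d | D d /\ forall d', D d' -> phi d <= phi d'].

Definition descent_steps (Rt : E -> E -> E) Theta (N : set E) (e : R) : set E :=
  argmin (feasible Rt Theta N e) (fun d => Phi (Rt Theta d)).

(* lim_{e -> 0+} (1 / e) A e = v for a set-valued A: A e is eventually
   nonempty, and (1 / e) A e is eventually inside each neighbourhood of v. *)
Definition rescaled_limit (A : R -> set E) (v : E) : Prop :=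
  (\forall e \near (0 : R)^'+, A e !=set0) /\
  (forall W, nbhs v W ->
     \forall e \near (0 : R)^'+, forall d, A e d -> W (e^-1 *: d)).

Definition natural_direction Theta : E :=
  inv_on (tangent M Theta) (fisher Theta) (rgrad M Phi Theta).

Definition dual_norm Theta : R :=
  Num.sqrt (inner (rgrad M Phi Theta) (natural_direction Theta)).

End Model.

(* Main.v *)
Require Import Defs.
From mathcomp Require Import measurable_realfun lra ring.

(** In the retraction chart at [Theta] the mean divergence [K] from [Theta]
vanishes to first order, because densities integrate to 1, and its Hessian there
is the covariance of the score, i.e. the Fisher matrix on the tangent space.
Hence for tangent [d], [K (R d) = d^T F d / 2 + o(|d|^2)], while
[Phi (R d) = Phi Theta + <grad Phi, d> + o(|d|)].  Coercivity of [F] forces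
feasible steps to have size [O(e)].  Comparing a minimiser [e *: u] with the
feasible step [(1 - eta) * e *: v], where [v] minimises the linear part on the
ellipsoid [v^T F v <= 1], bounds [(u - v)^T F (u - v)] by a quantity tending
to 0. *)

(** Two features of the setting shape the proof. The Fisher matrix acts on all of ['cV_(m * n)] but
    vanishes on the orthogonal complement of the tangent space. The tangent space is therefore shown
    to be linear and handled through the matrix [Pi] of its orthogonal projection, which also turns
    the choice-based [orth_proj] and [inv_on] into equations. A retraction is smooth only on the
    tangent bundle, which is not open in general, so near 0 it is replaced by a map differentiable
    on an ambient neighbourhood. The final comparison closes because [F v = - g / s]: the linear
    part at [u] is then [- s] times [u^T F v]. Near-optimality of [u] thus bounds
    [(u - v)^T F (u - v)] directly, with no extraction of convergent subsequences. *)

Set Implicit Arguments.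
Unset Strict Implicit.
Unset Printing Implicit Defensive.

Local Open Scope classical_set_scope.
Local Open Scope ring_scope.

(** * Integration against a density *)

Section Density.
Context (d : measure_display) (T : measurableType d) (R : realType).
Variables (mu : {sigma_finite_measure set T -> \bar R}) (nu : probability T R).
Variable q : T -> R.
Hypotheses (q_ge0 : forall y, 0 <= q y) (mq : measurable_fun setT q).
Hypothesis nuE : forall A, measurable A -> nu A = (\int[mu]_(y in A) (q y)%:E)%E.

Lemma density_dominated : nu `<< mu.
Proof.
apply/null_content_dominatesP => A mA A0; rewrite nuE// null_set_integral//.
by apply/measurable_EFinP; exact: measurable_funTS.
Qed.

(** The Radon-Nikodym derivative of [nu] and [q] have the same integral over every measurable set,
    so they agree [mu]-almost everywhere and can be exchanged in the change of variables. *)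
Lemma ge0_integral_density (h : T -> \bar R) : (forall y, 0 <= h y)%E ->
  measurable_fun setT h ->
  (\int[nu]_y h y = \int[mu]_y (h y * (q y)%:E))%E.
Proof.
move=> h0 mh; have numu := density_dominated.
have mE : measurable_fun setT (EFin \o q) by exact/measurable_EFinP.
have mf := Radon_Nikodym_SigmaFinite.f_integrable numu.
rewrite -(Radon_Nikodym_SigmaFinite.change_of_variables numu h0 measurableT mh).
apply: ge0_ae_eq_integral => //.
- by apply: emeasurable_funM => //; exact: measurable_int mf.
- exact: emeasurable_funM.
- by move=> y _; rewrite mule_ge0//; exact: Radon_Nikodym_SigmaFinite.f_ge0.
- by move=> y _; rewrite mule_ge0// lee_fin.
have : ae_eq mu setT (Radon_Nikodym_SigmaFinite.f nu mu) (EFin \o q).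
  apply: integral_ae_eq => // A _ mA.
  rewrite -(nuE mA); have := Radon_Nikodym_SigmaFinite.f_integral numu mA; exact: esym.
by apply: filterS => y E _; rewrite E.
Qed.

(** Multiplication by [q >= 0] commutes with taking positive and negative parts, so the identity
    holds in the extended reals whether or not [h] is integrable. *)
Lemma integral_density (h : T -> R) : measurable_fun setT h ->
  (\int[nu]_y (h y)%:E = \int[mu]_y (h y * q y)%:E)%E.
Proof.
move=> mh; have mE : measurable_fun setT (EFin \o h) by exact/measurable_EFinP.
rewrite integralE [RHS]integralE; congr (_ - _)%E.
- rewrite ge0_integral_density//; last exact: measurable_funepos.
  apply: eq_integral => y _; rewrite !funeposE EFinM muleC [in RHS]muleC.
  by rewrite maxe_pMr// ?mule0// lee_fin.
- rewrite ge0_integral_density//; last exact: measurable_funeneg.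
  apply: eq_integral => y _; rewrite !funenegE EFinM muleC [in RHS]muleC -muleN.
  by rewrite maxe_pMr// ?mule0// lee_fin.
Qed.

End Density.

Section DensityFubini.
Context (dX dY : measure_display) (X : measurableType dX) (Y : measurableType dY).
Variables (R : realType).
Variables (Px : probability X R) (mu : {sigma_finite_measure set Y -> \bar R}).

Lemma Rintegral_prod (f : X * Y -> R) :
  (Px \x mu)%E.-integrable setT (fun w => (f w)%:E) ->
  \int[Px]_x \int[mu]_y f (x, y) = \int[(Px \x mu)%E]_w f w.
Proof.
move=> fi; rewrite /Rintegral; congr fine.
have mF := measurable_fubini_F fi.
(* The inner real integral is [fine] of the extended one; they agree for almost every [x], namely
   where the section is integrable. *)
rewrite -(integral12_prod_meas1 fi); apply: ae_eq_integral => //.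
  apply/measurable_EFinP; apply: (@measurableT_comp _ _ _ _ _ _ fine) => //.
have := ae_integrable1 fi.
by apply: filterS => x xi _; rewrite fineK//; exact: integrable_fin_num.
Qed.

Lemma Rintegral_density_prod (q h : X * Y -> R) (P : X -> probability Y R) :
  (forall w, 0 < q w) -> (forall x, measurable_fun setT (fun y => q (x, y))) ->
  (forall x A, measurable A -> P x A = (\int[mu]_(y in A) (q (x, y))%:E)%E) ->
  (Px \x mu)%E.-integrable setT (fun w => (h w * q w)%:E) ->
  \int[Px]_x \int[P x]_y h (x, y) = \int[(Px \x mu)%E]_w (h w * q w).
Proof.
move=> q0 mq PE hi; rewrite -Rintegral_prod//.
apply: eq_Rintegral => x _; rewrite /Rintegral (integral_density _ (mq x) (PE x))//.
  by move=> y; exact: ltW.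
have mhq : measurable_fun setT (fun y => h (x, y) * q (x, y)).
  have /measurable_EFinP/(measurable_fun_pair2 x) := measurable_int _ hi.
  by [].
(* Measurability is known for the product [h * q]; [h] is recovered by dividing by [q > 0], with the
   inverse written [expR (- ln q)] so that it is measurable by composition. *)
rewrite (_ : (fun y => h (x, y)) =
    (fun y => (h (x, y) * q (x, y)) * expR (- ln (q (x, y))))); last first.
  by apply/funext => y; rewrite expRN lnK ?posrE// mulfK// gt_eqF.
apply: measurable_funM => //.
apply: measurableT_comp => //; apply: measurableT_comp => //.
by apply: measurableT_comp => //; exact: measurable_ln.
Qed.

End DensityFubini.

(** * Linear algebra and topology of matrix spaces *)

Section MatrixSpace.
Context (R : realType) (m n : nat).
Local Notation E := 'M[R]_(m, n).

Lemma vecB (A B : E) : vec (A - B) = vec A - vec B.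
Proof. by rewrite /vec !linearB. Qed.

Lemma vecZ a (A : E) : vec (a *: A) = a *: vec A.
Proof. by rewrite /vec !linearZ. Qed.

Lemma vecN (A : E) : vec (- A) = - vec A.
Proof. by rewrite /vec !linearN. Qed.

Lemma vec0 : vec (0 : E) = 0.
Proof. by rewrite /vec !linear0. Qed.

Lemma vec_inj : injective (@vec R m n).
Proof. by move=> A B /trmx_inj /(can_inj mxvecK). Qed.

Lemma vec_surj (v : 'cV[R]_(m * n)) : exists A : E, vec A = v.
Proof. by exists (vec_mx v^T); rewrite /vec vec_mxK trmxK. Qed.

Lemma vec_indexE (A : E) i j : vec A (mxvec_index i j) 0 = A i j.
Proof. by rewrite /vec mxE mxvecE. Qed.

Lemma innerE (A B : E) : inner A B = \sum_i \sum_j A i j * B i j.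
Proof.
rewrite /inner mxE (reindex _ (curry_mxvec_bij _ _)) pair_bigA /=.
by apply: eq_bigr => -[i j] _ /=; rewrite [(_^T) _ _]mxE !vec_indexE.
Qed.

Lemma innerC (A B : E) : inner A B = inner B A.
Proof.
by rewrite !innerE; apply: eq_bigr => i _; apply: eq_bigr => j _; rewrite mulrC.
Qed.

Lemma mulmx_tr_self_eq0 k (v : 'cV[R]_k) : (v^T *m v) 0 0 = 0 -> v = 0.
Proof.
rewrite mxE => /eqP; rewrite psumr_eq0; last first.
  by move=> i _; rewrite mxE -expr2 sqr_ge0.
move=> /allP v0; apply/colP => i; rewrite [RHS]mxE.
by have := v0 i (mem_index_enum _); rewrite mxE /= mulf_eq0 orbb => /eqP.
Qed.

Lemma unitmx_col_inj k (M : 'M[R]_k) :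
  (forall v : 'cV[R]_k, M *m v = 0 -> v = 0) -> M \in unitmx.
Proof.
move=> Mi; rewrite -unitmx_tr -row_free_unit; apply: inj_row_free => v vM.
by apply: trmx_inj; rewrite trmx0; apply: Mi; rewrite -[M]trmxK -trmx_mul vM trmx0.
Qed.

(** This is the classical formula [B^T (B B^T)^-1 B], where the rows of [B] are the vectorised basis
    of [W]. The Gram matrix is invertible: if it kills [v], then [B^T v] has norm 0, and freeness of
    the basis gives [v = 0]. *)
Lemma vspace_projector (W : {vspace E}) :
  exists Pi : 'M[R]_(m * n), [/\ Pi^T = Pi,
    forall A, A \in W -> Pi *m vec A = vec A &
    forall v, exists2 A : E, A \in W & vec A = Pi *m v].
Proof.
pose B : 'M[R]_(\dim W, m * n) := \matrix_(i < \dim W) mxvec (vbasis W)`_i.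
have BE (c : 'rV_(\dim W)) : c *m B = mxvec (\sum_i c 0 i *: (vbasis W)`_i).
  rewrite mulmx_sum_row linear_sum; apply: eq_bigr => i _.
  by rewrite rowK linearZ.
have Gu : B *m B^T \in unitmx.
  apply: unitmx_col_inj => v Gv.
  have Bv0 : B^T *m v = 0.
    by apply: mulmx_tr_self_eq0; rewrite trmx_mul trmxK -mulmxA [B *m _]mulmxA Gv mulmx0 mxE.
  have := congr1 trmx Bv0; rewrite trmx_mul trmxK trmx0 BE.
  have /freeP Wf := basis_free (vbasisP W).
  move=> /(canRL mxvecK); rewrite linear0 => /Wf v0.
  by apply/colP => i; have := v0 i; rewrite !mxE.
pose Pi := B^T *m invmx (B *m B^T) *m B.
have PiT : Pi^T = Pi.
  by rewrite /Pi !trmx_mul trmx_inv trmx_mul !trmxK mulmxA.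
exists Pi; split => // [A AW|v].
  have -> : vec A = B^T *m (\row_i coord (vbasis W) i A)^T.
    rewrite -trmx_mul BE /vec; congr (_^T); congr mxvec.
    by rewrite [LHS](coord_vbasis AW); apply: eq_bigr => i _; rewrite mxE.
  rewrite /Pi -!mulmxA (mulmxA B) (mulmxA (invmx _)) mulVmx// mul1mx//.
pose c := (invmx (B *m B^T) *m B *m v)^T.
exists (\sum_i c 0 i *: (vbasis W)`_i).
  by apply: memv_suml => i _; apply/memvZ/vbasis_mem/mem_nth; rewrite size_tuple.
by rewrite /vec -BE trmx_mul /c trmxK /Pi !mulmxA.
Qed.

Lemma mx_linear_continuous (V : normedModType R) (f : {linear E -> V}) :
  continuous f.
Proof.
have -> : (f : E -> V) = \sum_i \sum_j (fun A : E => A i j *: f (delta_mx i j)).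
  apply/funext => A; rewrite {1}[A]matrix_sum_delta linear_sum fct_sumE.
  apply: eq_bigr => i _; rewrite linear_sum fct_sumE.
  by apply: eq_bigr => j _; rewrite linearZ.
move=> x; elim/big_ind : _ => [|g h|i _]; [exact: cst_continuous|exact: continuousD|].
elim/big_ind : _ => [|g h|j _]; [exact: cst_continuous|exact: continuousD|].
have H := @coord_continuous R m n i j x.
by have := @cvgZr_tmp _ _ _ _ _ _ _ (f (delta_mx i j)) H; exact.
Qed.

End MatrixSpace.

Lemma mx_bounded_closed_compact (R : realType) (m n : nat) (A : set 'M[R]_(m, n)) :
  bounded_set A -> closed A -> compact A.
Proof.
move=> bA cA.
have cv : continuous (@vec_mx R m n) by exact: mx_linear_continuous.
have -> : A = @vec_mx R m n @` (@vec_mx R m n @^-1` A).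
  by apply/seteqP; split=> [x Ax|_ [v Av <-]//]; exists (mxvec x); rewrite /= mxvecK.
apply: continuous_compact.
  by apply: continuous_subspaceT.
apply: bounded_closed_compact.
  have [k k0 kP] := linear_lipschitz (@mx_linear_continuous R m n _ (@mxvec R m n)).
  have [M [Mr MP]] := bA.
  exists (k * (`|M| + 1)); split; first exact: num_real.
  move=> x xM v /= Av; rewrite -[v]vec_mxK; apply: le_trans (kP _) _.
  apply: le_trans (ltW xM); rewrite ler_pM2l//; apply: MP => //.
  by rewrite (le_lt_trans (ler_norm _))// ltrDl.
by apply: closed_comp => // v _; exact: cv.
Qed.

Section OrthProj.
Context (R : realType) (m n : nat) (T : set 'M[R]_(m, n)) (Pi : 'M[R]_(m * n)).
Local Notation E := 'M[R]_(m, n).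
Hypotheses (PiT : Pi^T = Pi) (Pi_id : forall A, T A -> Pi *m vec A = vec A).
Hypothesis Pi_im : forall v, exists2 A : E, T A & vec A = Pi *m v.

Lemma projector_idem : Pi *m Pi = Pi.
Proof.
apply/matrixP => i j.
have [A TA AE] := Pi_im (delta_mx j 0).
have := congr1 (fun v : 'cV_(m * n) => v i 0) (Pi_id TA).
rewrite AE mulmxA -!colE => E1; have := E1; by rewrite !mxE.
Qed.

Lemma orth_projE (A : E) :
  T (orth_proj T A) /\ vec (orth_proj T A) = Pi *m vec A.
Proof.
rewrite /orth_proj; case: xgetP => [B _ [TB BP]|nB].
  split=> //; set y := vec A - vec B.
  (* Testing the orthogonality of the residual [y] against its own projection gives
     [|Pi y|^2 = 0]. *)
  have [C TC CE] := Pi_im y.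
  have := BP C TC; rewrite /inner vecB -/y CE.
  have -> : y^T *m (Pi *m y) = (Pi *m y)^T *m (Pi *m y).
    by rewrite trmx_mul PiT -mulmxA (mulmxA Pi Pi) projector_idem.
  move=> /mulmx_tr_self_eq0 /eqP.
  by rewrite mulmxBr (Pi_id TB) subr_eq0 => /eqP ->.
have [B TB BE] := Pi_im (vec A).
case: (nB B); split => // C TC; rewrite /inner vecB BE.
rewrite linearB /= mulmxBl trmx_mul PiT -mulmxA (Pi_id TC) subrr.
by rewrite mxE.
Qed.

(** [F] is completed to [F + (1 - Pi)], which is invertible: a kernel vector is killed by
    [F = Pi (F + 1 - Pi)], hence is fixed by [Pi] and lies in [T], where positivity excludes it. The
    same identity shows that the solution has no component off [T]. *)
Lemma posdef_solve (F : 'M[R]_(m * n)) (A : E) : Pi *m F = F -> T A ->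
  posdef_on T F -> exists2 B : E, T B & F *m vec B = vec A.
Proof.
move=> PiF TA Fpos.
have PiM : Pi *m (F + (1%:M - Pi)) = F.
  by rewrite mulmxDr PiF mulmxBr mulmx1 projector_idem subrr addr0.
have Mu : F + (1%:M - Pi) \in unitmx.
  apply: unitmx_col_inj => v Mv.
  have Fv : F *m v = 0 by rewrite -PiM -mulmxA Mv mulmx0.
  have vE : v = Pi *m v.
    by move: Mv; rewrite mulmxDl Fv add0r mulmxBl mul1mx => /eqP; rewrite subr_eq0 => /eqP.
  have [B TB BE] := Pi_im v; rewrite -vE in BE.
  have [B0|B0] := eqVneq B 0; first by rewrite -BE B0 vec0.
  by have := Fpos B TB B0; rewrite BE -mulmxA Fv mulmx0 mxE ltxx.
have [B BE] := vec_surj (invmx (F + (1%:M - Pi)) *m vec A).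
have MB : (F + (1%:M - Pi)) *m vec B = vec A by rewrite BE mulKVmx.
have FB : F *m vec B = vec A by rewrite -{1}PiM -mulmxA MB Pi_id.
exists B => //; move: MB; rewrite mulmxDl FB mulmxBl mul1mx => /eqP.
rewrite eq_sym addrC -subr_eq subrr eq_sym subr_eq0 => /eqP vB.
have [C TC CE] := Pi_im (vec B); rewrite -vB in CE.
by rewrite -(vec_inj CE).
Qed.

End OrthProj.

(** * Differential calculus *)

Section Calculus.
Context (R : realType) (V W : normedModType R).
Implicit Types (f g : V -> W).

Lemma diff_near f x (e : R) : differentiable f x -> 0 < e ->
  \forall h \near (0 : V), `|f (x + h) - f x - 'D_h f x| <= e * `|h|.
Proof.
move=> df e0.
have := diff_locallyxC df; set k := 'o _ => fE.
have /(littleoP [littleo of k]) : 0 < e by [].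
apply: filterS => h; rewrite fE deriveE//.
rewrite (_ : f x + 'd f x h + k h - f x - 'd f x h = k h)//.
by rewrite -addrA -opprD [LHS]addrC addrA addNr add0r.
Qed.

(** [g] is [f] plus a function that vanishes near [x], and such a function has differential 0. *)
Lemma near_eq_differentiable f g x :
  {near x, f =1 g} -> differentiable f x -> differentiable g x.
Proof.
move=> fg df; have -> : g = f + (g - f) by rewrite addrC subrK.
apply: differentiableD => //; set z := g - f.
have zx : z x = 0 by rewrite -[z x]/(g x - f x) (nbhs_singleton fg) subrr.
have zE : z \o shift x = cst (z x) + (\0 : V -> W) +o_ 0 id.
  apply/eqaddoP => e e0.
  have : \forall h \near (0 : V), f (h + x) = g (h + x).
    by move: fg; rewrite (near_shift 0 x) /= subr0.
  apply: filterS => h fgh.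
  rewrite (_ : _ h = z (h + x) - (z x + 0))// zx addr0 subr0.
  by rewrite -[z _]/(g (h + x) - f (h + x)) fgh subrr normr0 mulr_ge0// ltW.
have dz : 'd z x = (\0 : V -> W) :> (V -> W).
  by apply: diff_unique => // y; exact: cst_continuous.
apply/diff_locallyP; rewrite dz; split => //; exact: cst_continuous.
Qed.

Lemma is_derive_line f (a v : V) (t : R) : differentiable f (a + t *: v) ->
  is_derive t 1 (fun s : R => f (a + s *: v)) ('D_v f (a + t *: v)).
Proof.
move=> df.
have dl : is_diff t (fun s : R => a + s *: v) (fun s => s *: v).
  have := @is_diffD R _ _ (cst a) (fun s : R => s *: v) 0 (fun s : R => s *: v) t _ _.
  rewrite add0r. exact.
have := differentiableP df => df'.
have H := is_diff_comp dl df'.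
apply: DeriveDef; first exact/diff_derivable/ex_diff.
rewrite deriveE; last exact: ex_diff.
by rewrite (@diff_val _ _ _ _ _ _ _ H) /= scale1r deriveE.
Qed.

Lemma derive_comp_line f (a v : V) (t w : R) : differentiable f (a + t *: v) ->
  'D_w (fun s : R => f (a + s *: v)) t = 'D_(w *: v) f (a + t *: v).
Proof.
move=> df; have [dl dlE] := is_derive_line df.
have dl' := dl; move/derivable1_diffP in dl'.
rewrite (deriveE (w *: v) df) (deriveE w dl') -[w in LHS]mulr1.
rewrite -[w * 1]/(w *: 1) linearZ -(deriveE _ dl') dlE deriveE//.
by rewrite linearZ.
Qed.

Lemma near_eq_continuous_at f g x :
  {near x, f =1 g} -> {for x, continuous f} -> {for x, continuous g}.
Proof.
move=> fg cf; rewrite /prop_for /continuous_at -(nbhs_singleton fg).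
by apply: cvg_trans cf; exact: near_eq_cvg.
Qed.

End Calculus.

Lemma near0_norm (R : realType) (V : normedModType R) (P : V -> Prop) :
  (\forall d \near (0 : V), P d) ->
  exists2 r : R, 0 < r & forall d, `|d| < r -> P d.
Proof.
move=> /nbhs_normP[r /= r_gt0 rP]; exists r => // d dr; apply: rP.
by rewrite /= sub0r normrN.
Qed.

Section SmoothFunctions.
Context (R : realType).

Lemma Ck_on_eq (V W : normedModType R) k (U : set V) (f g : V -> W) : open U ->
  (forall x, U x -> f x = g x) -> Ck_on k U f -> Ck_on k U g.
Proof.
move=> oU; have near_eq (f' g' : V -> W) x : (forall x, U x -> f' x = g' x) ->
    U x -> {near x, f' =1 g'}.
  by move=> fg Ux; apply: filterS (open_nbhs_nbhs (conj oU Ux)) => y; exact: fg.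
elim: k f g => [|k IH] f g fg /=.
  by move=> cf x Ux; apply: near_eq_continuous_at (cf x Ux); exact: near_eq.
move=> [df Df]; split=> [x Ux|v].
  by apply: near_eq_differentiable (df x Ux); exact: near_eq.
by apply: IH (Df v) => x Ux; apply: near_eq_derive; exact: near_eq.
Qed.

Lemma Ck_on_subset (V W : normedModType R) k (U U' : set V) (f : V -> W) :
  U' `<=` U -> Ck_on k U f -> Ck_on k U' f.
Proof.
move=> UU; elim: k f => [|k IH] f /=; first by move=> cf x /UU; exact: cf.
by move=> [df Df]; split => [x /UU|v]; [exact: df|exact: IH].
Qed.

(** The induction closes because differentiating along the line by [w] yields the restriction to the
    same line of ['D_(w *: v) f]. *)
Lemma Ck_on_line (V W : normedModType R) k (U : set V) (f : V -> W) (a v : V) :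
  open U -> Ck_on k U f ->
  Ck_on k [set t : R | U (a + t *: v)] (fun t : R => f (a + t *: v)).
Proof.
move=> oU; have cl : continuous (fun t : R => a + t *: v).
  move=> t; apply: cvgD; first exact: cvg_cst.
  exact: scalel_continuous.
have oL : open [set t : R | U (a + t *: v)].
  by apply: open_comp oU => t _; exact: cl.
elim: k f => [|k IH] f /=.
  by move=> cf t Ut; apply: (continuous_comp (cl t)); exact: cf.
move=> [df Df]; split=> [t Ut|w].
  by apply/derivable1_diffP; have [] := is_derive_line (df _ Ut).
apply: Ck_on_eq (IH _ (Df (w *: v))) => // t Ut.
by rewrite derive_comp_line//; exact: df.
Qed.

End SmoothFunctions.

Section MatrixCalculus.
Context (R : realType) (m n : nat).
Local Notation E := 'M[R]_(m, n).

Lemma mx_norm_ge (A : E) i j : `|A i j| <= `|A|.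
Proof.
by rewrite [leRHS]/Num.norm /= mx_normrE; apply/bigmax_geP; right; exists (i, j).
Qed.

Lemma derive_egrad (f : E -> R) (x v : E) : differentiable f x ->
  'D_v f x = inner (egrad f x) v.
Proof.
move=> df; rewrite deriveE// {1}[v]matrix_sum_delta linear_sum innerE.
apply: eq_bigr => i _; rewrite linear_sum; apply: eq_bigr => j _.
by rewrite linearZ mxE deriveE// mulrC.
Qed.

(** A Peano remainder, obtained from the mean value theorem for [K] on the segment minus the
    expected parabola. The derivative of this difference is small because each partial derivative of
    [K] vanishes at [x] and is differentiable there. *)
Lemma taylor2 (K : E -> R) (U : set E) (x : E) (e : R) : open U -> U x ->
  (forall y, U y -> differentiable K y) ->
  (forall u, differentiable ('D_u K) x) -> (forall u, 'D_u K x = 0) -> 0 < e ->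
  \forall h \near (0 : E),
    `|K (x + h) - K x - 'D_h ('D_h K) x / 2| <= e * `|h| ^+ 2.
Proof.
move=> oU Ux dK d2K dK0 e0.
(* The tolerance [e] is shared among the [m * n] entries; the [+ 1] keeps the divisor positive for
   empty matrices. *)
pose c := (m * n)%:R + 1 : R.
have c0 : 0 < c by rewrite /c ltr_wpDl.
have DE y h : U y -> 'D_h K y = \sum_i \sum_j h i j * 'D_(delta_mx i j) K y.
  move=> Uy; rewrite derive_egrad; last exact: dK.
  rewrite innerE; apply: eq_bigr => i _; apply: eq_bigr => j _.
  by rewrite mxE mulrC.
have D2E h : 'D_h ('D_h K) x = \sum_i \sum_j h i j * 'D_h ('D_(delta_mx i j) K) x.
  have -> : 'D_h ('D_h K) x = 'D_h (\sum_i \sum_j (h i j \*: 'D_(delta_mx i j) K)) x.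
    apply: near_eq_derive.
    apply: filterS (open_nbhs_nbhs (conj oU Ux)) => y Uy.
    rewrite DE// fct_sumE; apply: eq_bigr => i _; rewrite fct_sumE.
    by apply: eq_bigr.
  have dd i j v : derivable (h i j \*: 'D_(delta_mx i j) K) x v.
    exact/diff_derivable/differentiableZ.
  rewrite derive_sum; last by move=> i; exact: derivable_sum.
  apply: eq_bigr => i _; rewrite derive_sum//; apply: eq_bigr => j _.
  by rewrite deriveZ//; exact: diff_derivable.
have ec0 : 0 < e / c by rewrite divr_gt0.
have near1 : \forall h \near (0 : E), U (x + h) /\ forall i j,
    `|'D_(delta_mx i j) K (x + h) - 'D_h ('D_(delta_mx i j) K) x| <= e / c * `|h|.
  apply: filterI.
    have : \near x, U x by exact: open_nbhs_nbhs.
    by rewrite (near_shift 0 x) /= subr0; apply: filterS => h /=; rewrite addrC.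
  have near2 : \forall h \near (0 : E), forall p : 'I_m * 'I_n,
      `|'D_(delta_mx p.1 p.2) K (x + h) - 'D_h ('D_(delta_mx p.1 p.2) K) x|
        <= e / c * `|h|.
    refine (@filter_forall E ('I_m * 'I_n)%type (fun p h =>
      `|'D_(delta_mx p.1 p.2) K (x + h) - 'D_h ('D_(delta_mx p.1 p.2) K) x|
        <= e / c * `|h|) (nbhs (0 : E)) _ _) => p.
    have := diff_near (d2K (delta_mx p.1 p.2)) ec0.
    by apply: filterS => h; rewrite dK0 subr0.
  by apply: filterS near2 => h hP i j; exact: (hP (i, j)).
have [r r0 rP] := (nbhs_normP _ _).1 near1.
apply/nbhs_normP; exists r => //= h; rewrite /= sub0r normrN => hr.
have {}rP (t : R) : 0 <= t <= 1 -> U (x + t *: h) /\ forall i j,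
    `|'D_(delta_mx i j) K (x + t *: h) - t * 'D_h ('D_(delta_mx i j) K) x|
      <= e / c * `|h|.
  move=> /andP[t0 t1].
  have th : `|t *: h| <= `|h| by rewrite normrZ ger0_norm// ler_piMl.
  have /rP[Uth dth] : ball_ Num.norm 0 r (t *: h).
    by rewrite /= sub0r normrN (le_lt_trans th).
  split=> // i j; apply: (@le_trans _ _ (e / c * `|t *: h|)).
    have := dth i j; rewrite (deriveE (t *: h) (d2K (delta_mx i j))).
    by rewrite (deriveE h (d2K (delta_mx i j))) [in X in X -> _]linearZ.
  by rewrite ler_pM2l.
pose H : R := 'D_h ('D_h K) x.
pose phi t : R := K (x + t *: h) - t ^+ 2 * (H / 2).
pose dphi t : R := 'D_h K (x + t *: h) - t * H.
have dphiP (t : R) : 0 <= t <= 1 -> is_derive t 1 phi (dphi t).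
  move=> /rP[Ut _]; have := is_derive_line (dK _ Ut) => HK.
  have Hsq : is_derive t 1 (fun t : R => t ^+ 2 * (H / 2)) (t * H).
    have h1 : is_derive t 1 (@id R) 1 by exact: is_derive_id.
    have h2 := is_deriveX 2 h1.
    have h3 := is_deriveZ (H / 2) h2.
    have -> : (fun t : R => t ^+ 2 * (H / 2)) = (H / 2) \*: (id ^+ 2).
      by apply/funext => s /=; rewrite fctE mulrC.
    apply: is_derive_eq h3 _.
    rewrite /GRing.scale /= expr1; by field.
  by have := is_deriveB HK Hsq; exact.
have [t t01 tE] : exists2 t : R, t \in `[0, 1]%R & phi 1 - phi 0 = dphi t * (1 - 0).
  apply: MVT_segment => // [t|].
    by rewrite in_itv /= => /andP[t0 t1]; apply: dphiP; rewrite !ltW.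
  apply: derivable_within_continuous => t; rewrite in_itv /= => t01.
  by have [] := dphiP _ t01.
have -> : K (x + h) - K x - 'D_h ('D_h K) x / 2 = dphi t.
  move: tE; rewrite subr0 mulr1 => <-.
  by rewrite /phi scale1r scale0r addr0 expr0n expr1n mul0r mul1r subr0 addrAC.
rewrite in_itv /= in t01; have [Ut tP] := rP _ t01.
rewrite /dphi /H D2E DE// mulr_sumr -sumrB.
have -> : e * `|h| ^+ 2 = e / c * c * `|h| ^+ 2 by rewrite divfK// gt_eqF.
apply: (@le_trans _ _ (\sum_(i < m) \sum_(j < n) (e / c * `|h| ^+ 2))); last first.
  rewrite !sumr_const !card_ord -!mulrnA mulnC -mulr_natr [leLHS]mulrAC.
  by rewrite ler_wpM2r ?exprn_ge0// ler_pM2l// lerDl.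
apply: le_trans (ler_norm_sum _ _ _) _; apply: ler_sum => i _.
rewrite mulr_sumr -sumrB.
apply: le_trans (ler_norm_sum _ _ _) _; apply: ler_sum => j _.
rewrite mulrCA -mulrBr normrM mulrC expr2 mulrA.
by apply: ler_pM => //; exact: mx_norm_ge.
Qed.

End MatrixCalculus.

(** * The tangent space *)

Section TangentSpace.
Context (R : realType) (m n : nat).
Local Notation E := 'M[R]_(m, n).

Lemma vspace_closed (S : {vspace E}) : closed [set x : E | x \in S].
Proof.
have -> : [set x : E | x \in S] = (projv S - \1)%VF @^-1` [set 0].
  apply/seteqP; split=> x /=; rewrite add_lfunE opp_lfunE id_lfunE.
    by move=> xS; rewrite projv_id// subrr.
  by move=> /eqP; rewrite subr_eq0 => /eqP <-; exact: memv_proj.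
apply: closed_comp; last first.
  exact/accessible_closed_set1/hausdorff_accessible/norm_hausdorff.
by move=> x _; exact: mx_linear_continuous.
Qed.

Lemma derive_in_vspace (S : {vspace E}) (c : R -> E) :
  derivable c 0 1 -> (\forall t \near (0 : R), c t \in S) -> 'D_1 c 0 \in S.
Proof.
move=> dc cS.
have dc' : (fun h : R => h^-1 *: (c (h *: (1 : R^o) + 0) - c 0)) @ (0 : R)^'
  --> 'D_1 c 0 := dc.
apply: (closed_cvg _ (@vspace_closed S) _ _ dc').
have : \forall t \near (0 : R)^', c t \in S by exact: cvg_within.
apply: filterS => t ct /=; rewrite /GRing.scale /= mulr1 addr0.
by rewrite memvZ// memvB//; exact: nbhs_singleton cS.
Qed.

(** Velocities of curves in [M] cannot be added directly, so the tangent space is identified with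
    the preimage of the slice [S] under the differential of the straightening map [psi]. *)
Lemma tangent_vspace d (M : set E) (Theta : E) :
  embedded_submanifold d M -> M Theta ->
  exists W : {vspace E}, tangent M Theta = [set xi | xi \in W].
Proof.
move=> Msub MT.
have [U [V [psi [phi [S [[oU UT oV] [[spsi sphi pU pV] [_ MS]]]]]]]] := Msub _ MT.
have dpsi : differentiable psi Theta := (spsi 1).1 _ UT.
have [Va phia] := pU _ UT.
have dphi : differentiable phi (psi Theta) := (sphi 1).1 _ Va.
exists (linfun ('d psi Theta) @^-1: S)%VS; apply/seteqP; split=> xi /=.
  move=> [e [c [e0 sc cM c0 cxi]]]; rewrite -memv_preim lfunE /=.
  have dc : differentiable c (0 : R) := (sc 1).1 _ (ballxx _ e0).
  have dpsic : differentiable psi (c 0) by rewrite c0.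
  have dpc := differentiable_comp dc dpsic.
  rewrite -cxi -c0 (deriveE _ dc).
  have <- : 'D_1 (psi \o c) 0 = 'd psi (c 0) ('d c 0 1).
    have H1 := deriveE (1 : R) dpc.
    have H2 := congr1 (fun f : R -> E => f 1) (diff_comp dc dpsic).
    by apply: (etrans H1); exact: H2.
  apply: derive_in_vspace; first exact: diff_derivable.
  have cU : \forall t \near (0 : R), U (c t).
    by apply: (differentiable_continuous dc); apply: open_nbhs_nbhs; rewrite c0.
  have cb : \forall t \near (0 : R), ball (0 : R) e t by exact: nbhsx_ballx.
  apply: filterS2 cU cb => t Ut bt /=.
  by apply/(MS _ Ut); exact: cM.
rewrite -memv_preim lfunE /=; set eta := 'd psi Theta xi => etaS.
have lV : \forall t \near (0 : R), V (psi Theta + t *: eta).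
  have cl : {for 0, continuous (fun t : R => psi Theta + t *: eta)}.
    by apply: continuousD; [exact: cst_continuous|exact: scalel_continuous].
  by apply: cl; rewrite scale0r addr0; exact: open_nbhs_nbhs.
have /nbhs_ballP[e /= e0 eV] := lV.
(* A straight line in the slice, carried back to [M]; its velocity is [xi] because [phi \o psi] is
   the identity near [Theta]. *)
exists e, (fun t : R => phi (psi Theta + t *: eta)); split=> //.
- by move=> k; apply: (Ck_on_subset eV); exact: Ck_on_line.
- move=> t /eV Vt; have [Ut psit] := pV _ Vt.
  apply/(MS _ Ut); rewrite psit memvD ?memvZ//.
  exact/(MS _ UT).
- by rewrite scale0r addr0.
- rewrite derive_comp_line ?scale0r ?addr0// scale1r.
  rewrite (deriveE _ dphi) /eta.
  have H1 := deriveE xi (differentiable_comp dpsi dphi).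
  have H2 := congr1 (fun f : E -> E => f xi) (diff_comp dpsi dphi).
  apply: (etrans (esym (etrans H1 H2))).
  rewrite (near_eq_derive (g := id)) ?derive_id//.
  by apply: filterS (open_nbhs_nbhs (conj oU UT)) => y /pU[].
Qed.

End TangentSpace.

(** * Minimisation over shrinking sublevel sets *)

Section QuadraticForm.
Context (R : realType) (m n : nat) (F : 'M[R]_(m * n)).
Local Notation E := 'M[R]_(m, n).

Definition bform (A B : E) : R := ((vec A)^T *m F *m vec B) 0 0.

Lemma bformZ a (A : E) : bform (a *: A) (a *: A) = a ^+ 2 * bform A A.
Proof.
rewrite /bform vecZ [(_ *: _)^T]linearZ /= -scalemxAr -!scalemxAl scalerA mxE.
by rewrite -expr2.
Qed.

Lemma bformBB (A B : E) : F^T = F ->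
  bform (A - B) (A - B) = bform A A - 2 * bform A B + bform B B.
Proof.
move=> FT; have bC : bform B A = bform A B.
  have trE : ((vec B)^T *m F *m vec A)^T = (vec A)^T *m F *m vec B.
    by rewrite !trmx_mul (trmxK (vec B)) FT mulmxA.
  by rewrite /bform -trE [RHS]mxE.
have -> : bform (A - B) (A - B) = bform A A - bform B A - (bform A B - bform B B).
  have sub00 (X Y : 'M[R]_1) : (X - Y) 0 0 = X 0 0 - Y 0 0 by rewrite !mxE.
  by rewrite /bform vecB [(_ - _)^T]linearB /= mulmxBl mulmxBr !mulmxBl !sub00.
by rewrite bC; ring.
Qed.

Lemma bform_continuous : continuous (fun A : E => bform A A).
Proof.
have cv i : continuous (fun A : E => vec A i 0).
  have cvec : continuous (trmx \o mxvec : E -> 'cV[R]_(m * n)).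
    exact: mx_linear_continuous.
  move=> A; apply: (@continuous_comp _ _ _ _ (fun M : 'cV[R]_(m * n) => M i 0)).
    exact: cvec.
  exact: coord_continuous.
have -> : (fun A : E => bform A A) =
    \sum_j \sum_i (fun A : E => vec A i 0 * F i j * vec A j 0).
  apply/funext => A; rewrite /bform mxE fct_sumE; apply: eq_bigr => j _.
  rewrite mxE mulr_suml fct_sumE; apply: eq_bigr => i _.
  by rewrite [(_^T) _ _]mxE.
move=> A; elim/big_ind : _ => [|p q|j _]; [exact: cst_continuous|exact: continuousD|].
elim/big_ind : _ => [|p q|i _]; [exact: cst_continuous|exact: continuousD|].
have cF : {for A, continuous (cst (F i j) : E -> R)} by exact: cst_continuous.
by have := continuousM (continuousM (cv i A) cF) (cv j A); exact.
Qed.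

(** [c] is the minimum of the form on the compact unit sphere of [T]; homogeneity extends the bound
    to all of [T]. *)
Lemma posdef_coercive (T : set E) : closed T ->
  (forall a A, T A -> T (a *: A)) -> posdef_on T F ->
  exists2 c : R, 0 < c & forall A, T A -> c * `|A| ^+ 2 <= bform A A.
Proof.
move=> cT TZ Fpos.
have b0 : bform 0 0 = 0 by rewrite /bform vec0 mulmx0 mxE.
pose S := T `&` [set A | `|A| = 1].
have TS A : T A -> A != 0 -> S (`|A|^-1 *: A).
  move=> TA A0; split; first exact: TZ.
  by rewrite /= normrZ normfV normr_id mulVf// normr_eq0.
(* The sphere is empty when [T] contains no nonzero vector, and then any constant works. *)
have [S0|S0] := eqVneq S set0.
  exists 1 => // A TA; have [->|A0] := eqVneq A 0.
    by rewrite normr0 expr0n mulr0 b0.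
  by have := TS _ TA A0; rewrite S0.
have cS : compact S.
  apply: mx_bounded_closed_compact.
    exists 1; split; first exact: num_real.
    by move=> x x1 A /= [_ ->]; exact: ltW.
  apply: closedI => //.
  rewrite (_ : [set A | _] = (fun A : E => `|A|) @^-1` [set 1])//.
  apply: closed_comp; last first.
    exact/accessible_closed_set1/hausdorff_accessible/norm_hausdorff.
  by move=> x _; exact: norm_continuous.
have /set0P S0' := S0.
have [|A0] := @compact_EVT_min _ R (fun A : E => bform A A) S S0' cS.
  by apply: continuous_subspaceT; exact: bform_continuous.
rewrite inE => -[TA0 A01] minA0.
have A0n0 : A0 != 0 by rewrite -normr_eq0 A01 oner_eq0.
exists (bform A0 A0); first exact: Fpos.
move=> A TA; have [->|An0] := eqVneq A 0.
  by rewrite normr0 expr0n mulr0 b0.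
have := minA0 _ (mem_set (TS _ TA An0)).
by rewrite bformZ exprVn mulrC ler_pdivlMr// exprn_gt0// normr_gt0.
Qed.

End QuadraticForm.

Section DescentLimit.
Context (R : realType) (m n : nat).
Local Notation E := 'M[R]_(m, n).
Variables (T : set E) (F : 'M[R]_(m * n)) (g v : E) (s r0 : R) (k phi : E -> R).
Hypotheses (cT : closed T) (T0 : T 0) (TZ : forall a A, T A -> T (a *: A)).
Hypothesis (TB : forall A B, T A -> T B -> T (A - B)).
Hypotheses (FT : F^T = F) (Fpos : posdef_on T F).
Hypotheses (s0 : 0 < s) (Tv : T v) (Fv : F *m vec v = - s^-1 *: vec g).
Hypothesis gv : inner g v = - s.
Hypothesis r0_gt0 : 0 < r0.
Hypothesis kC : forall d, `|d| < r0 -> {for d, continuous k}.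
Hypothesis phiC : forall d, `|d| < r0 -> {for d, continuous phi}.
Hypothesis kE : forall e : R, 0 < e -> \forall d \near (0 : E), T d ->
  `|k d - bform F d d / 2| <= e * `|d| ^+ 2.
Hypothesis phiE : forall e : R, 0 < e -> \forall d \near (0 : E), T d ->
  `|phi d - phi 0 - inner g d| <= e * `|d|.

Let innerZ a (d : E) : inner g (a *: d) = a * inner g d.
Proof. by rewrite /inner vecZ -scalemxAr mxE. Qed.

(** [Fv] is the stationarity condition for the linear form [g] on the ellipsoid; combined with [gv],
    this identity also gives [v^T F v = 1]. *)
Let bv (d : E) : bform F d v = - (s^-1 * inner g d).
Proof.
rewrite /bform -mulmxA Fv -scalemxAr mxE mulNr; congr (- (_ * _)).
by rewrite !innerE [LHS](_ : _ = inner d g)// innerE;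
  apply: eq_bigr => i _; apply: eq_bigr => j _; rewrite mulrC.
Qed.

Let step_set (N : set E) (e : R) : set E :=
  [set d | [/\ N d, T d & k d <= e ^+ 2 / 2]].

Let k0 : k 0 = 0.
Proof.
have := nbhs_singleton (kE ltr01) T0.
rewrite normr0 expr0n mulr0 /bform vec0 mulmx0 mxE mul0r subr0 normr_le0.
by move/eqP.
Qed.

Lemma descent_limit : exists2 r1 : R, 0 < r1 &
  forall N : set E, nbhs (0 : E) N -> (forall d, N d -> `|d| < r1) ->
    rescaled_limit (fun e => argmin (step_set N e) phi) v.
Proof.
have [c c0 cP] := posdef_coercive cT TZ Fpos.
(* Half of the coercive bound [c / 2 * |d|^2] survives an error of [c / 4 * |d|^2], so
   [k d <= e^2 / 2] yields [c * |d|^2 <= 2 * e^2]. *)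
have [r2 r20 r2P] := near0_norm (kE (divr_gt0 c0 (ltr0n R 4))).
exists r2 => // N N0 Nr2.
pose x := 2 / c; have x0 : 0 < x by rewrite divr_gt0.
(* As [x <= (1 + x)^2], this [C] serves as a bound for the square root of [x]. *)
pose C := 1 + x; have C1 : 1 <= C by rewrite lerDl ltW.
have C0 : 0 < C by exact: lt_le_trans C1.
have dC (e : R) (d : E) : 0 < e -> step_set N e d -> `|d| <= C * e.
  move=> e0 [Nd Td kd].
  have := r2P _ (Nr2 _ Nd) Td; rewrite ler_norml => /andP[kd1 _].
  have cd := cP _ Td.
  have dx : `|d| ^+ 2 <= x * e ^+ 2.
    have : c * `|d| ^+ 2 <= 2 * e ^+ 2 by lra.
    by rewrite /x mulrAC ler_pdivlMr// mulrC.
  have Ce0 : 0 <= C * e by rewrite mulr_ge0 ?ltW.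
  rewrite -ler_sqr ?nnegrE//.
  apply: le_trans dx _; rewrite exprMn ler_wpM2r ?sqr_ge0// /C.
  by have := sqr_ge0 x; lra.
have [r3 r30 r3P] := near0_norm N0.
split.
  pose r4 := Num.min r3 r0 / 2.
  have r40 : 0 < r4 by rewrite divr_gt0// lt_min r30.
  have r43 : r4 < r3.
    rewrite /r4 ltr_pdivrMr//; apply: (@le_lt_trans _ _ r3); last by lra.
    by rewrite ge_min lexx.
  have r4r0 : r4 < r0.
    rewrite /r4 ltr_pdivrMr//; apply: (@le_lt_trans _ _ r0); last by rewrite mulr_natr mulr2n ltrDl.
    by rewrite ge_min lexx orbT.
  near=> e.
  have e0 : 0 < e by [].
  have er4 : C * e < r4.
    by rewrite mulrC -ltr_pdivlMr//; near: e; apply: nbhs_right_lt; rewrite divr_gt0.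
  (* [N] may fail to be closed, so the minimum is taken over a closed ball inside [N]; by [dC] this
     ball contains every feasible step once [C * e < r4]. *)
  pose D := [set d | [/\ T d, `|d| <= r4 & k d <= e ^+ 2 / 2]].
  have cD : compact D.
    apply: mx_bounded_closed_compact.
      exists r4; split; first exact: num_real.
      by move=> y y4 d /= [_ /le_trans + _]; apply; exact: ltW.
    move=> d dcl.
    have Td : T d by apply: cT => B /dcl[d' [[]]]; exists d'.
    have dr4 : `|d| <= r4.
      have cB : closed [set d : E | `|d| <= r4].
        rewrite (_ : [set d | _] = (fun A : E => `|A|) @^-1` [set y | y <= r4])//.
        apply: closed_comp; last exact: closed_le.
        by move=> y _; exact: norm_continuous.
      by apply: cB => B /dcl[d' [[]]]; exists d'.
    split => //; rewrite leNgt; apply/negP => kd.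
    have kB : nbhs d (k @^-1` [set y | e ^+ 2 / 2 < y]).
      apply: (kC (le_lt_trans dr4 r4r0)).
      apply: open_nbhs_nbhs; split => //; exact: open_gt.
    have [d' [[_ _]]] := dcl _ kB.
    by move=> /= /le_lt_trans /[apply]; rewrite ltxx.
  have D0 : D !=set0.
    exists 0; split => //; first by rewrite normr0 ltW.
    by rewrite k0 divr_ge0// sqr_ge0.
  have [|d0] := @compact_EVT_min _ R phi D D0 cD.
    apply: continuous_in_subspaceT => d; rewrite inE => -[_ dr4 _].
    exact: phiC (le_lt_trans dr4 r4r0).
  rewrite inE => -[Td0 d0r kd0] mind0.
  exists d0; split; first by split => //; apply: r3P; exact: le_lt_trans r43.
  move=> d' Dd'; apply: mind0; rewrite inE.
  have [_ Td' kd'] := Dd'; split => //.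
  exact: le_trans (dC _ _ e0 Dd') (ltW er4).
move=> W /nbhs_normP[del /= del0 delW].
(* The target is [(u - v)^T F (u - v) < kap], which coercivity turns into [|u - v| < del]. The
   budget is [kap / 8] for the excess of [u^T F u] over 1, [2 * eta <= kap / 4] for shrinking [v],
   and [2 * (kap / 16)] for the first-order errors: [kap / 2] in total. *)
pose kap := c * del ^+ 2; have kap0 : 0 < kap by rewrite mulr_gt0// exprn_gt0.
pose eta := Num.min (kap / 8) (1 / 2).
have eta0 : 0 < eta by rewrite lt_min !divr_gt0.
have eta1 : eta <= 1 / 2 by rewrite ge_min lexx orbT.
have etak : eta <= kap / 8 by rewrite ge_min lexx.
pose nv : R := `|v|; have nv0 : 0 <= nv by exact: normr_ge0.
have nv1 : 0 < nv ^+ 2 + 1 by rewrite ltr_wpDl// sqr_ge0.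
have C20 : 0 < C ^+ 2 by rewrite exprn_gt0.
(* The first bound controls [u^T F u]; the second makes the shrunken step [d'] feasible. *)
pose e1 := Num.min (kap / (16 * C ^+ 2)) (eta / (2 * (nv ^+ 2 + 1))).
have e10 : 0 < e1 by rewrite lt_min !divr_gt0// mulr_gt0.
have e1k : 2 * (e1 * C ^+ 2) <= kap / 8.
  have : e1 <= kap / (16 * C ^+ 2) by rewrite ge_min lexx.
  by rewrite ler_pdivlMr ?mulr_gt0//; lra.
have e1eta : 2 * (e1 * nv ^+ 2) <= eta.
  have : e1 <= eta / (2 * (nv ^+ 2 + 1)) by rewrite ge_min lexx orbT.
  by rewrite ler_pdivlMr ?mulr_gt0//; lra.
have Cv0 : 0 < C + nv by rewrite ltr_wpDr.
(* The minimiser and the competitor have norms at most [C * e] and [nv * e], so their first-order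
   errors add up to at most [s * (kap / 16) * e]. *)
pose e2 := s * kap / (16 * (C + nv)).
have e20 : 0 < e2 by rewrite /e2 !(divr_gt0, mulr_gt0).
have e2k : e2 * (C + nv) = s * (kap / 16).
  by rewrite /e2; field; rewrite gt_eqF.
have [r5 r50 r5P] := near0_norm (filterI (kE e10) (phiE e20)).
pose r6 := Num.min r3 r5.
have r60 : 0 < r6 by rewrite lt_min r30.
near=> e => d [Dd mind].
have e0 : 0 < e by [].
have er6 : (C + nv) * e < r6.
  by rewrite mulrC -ltr_pdivlMr//; near: e; apply: nbhs_right_lt; rewrite divr_gt0.
have Ce := dC _ _ e0 Dd; have [Nd Td kd] := Dd.
have nve : 0 <= nv * e by rewrite mulr_ge0// ltW.
have Ce0 : 0 <= C * e by rewrite mulr_ge0// ltW.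
have r65 : r6 <= r5 by rewrite ge_min lexx orbT.
have r63 : r6 <= r3 by rewrite ge_min lexx.
have [dk dphi] : `|k d - bform F d d / 2| <= e1 * `|d| ^+ 2 /\
    `|phi d - phi 0 - inner g d| <= e2 * `|d|.
  have [|dk dphi] := r5P d; first by lra.
  by split; [exact: dk|exact: dphi].
pose tau := 1 - eta; have tau0 : 0 < tau by rewrite /tau; lra.
pose d' := (tau * e) *: v.
have nd' : `|d'| = tau * e * nv.
  by rewrite normrZ ger0_norm// mulr_ge0// ltW.
have nd'e : `|d'| <= nv * e.
  by rewrite nd' mulrC; apply: ler_wpM2l => //; rewrite ler_piMl ?ltW// /tau; lra.
have Td' : T d' by exact: TZ.
have [d'k d'phi] : `|k d' - bform F d' d' / 2| <= e1 * `|d'| ^+ 2 /\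
    `|phi d' - phi 0 - inner g d'| <= e2 * `|d'|.
  have [|d'k d'phi] := r5P d'; first by lra.
  by split; [exact: d'k|exact: d'phi].
have bvv : bform F v v = 1 by rewrite bv gv mulrN opprK mulVf// gt_eqF.
have Dd' : step_set N e d'.
  split => //; first by apply: r3P; lra.
  move: d'k; rewrite bformZ bvv mulr1 nd' ler_norml => /andP[_ d'k].
  have e1v : e1 * (tau * e * nv) ^+ 2 <= (tau * e) ^+ 2 * (eta / 2).
    rewrite [(tau * e * nv) ^+ 2]exprMn mulrCA ler_wpM2l ?sqr_ge0//.
    by lra.
  (* The left side is [(1 - eta) * (1 - eta^2)]: shrinking by [tau] absorbs the relative error [eta]
     in [k d']. *)
  have te : tau ^+ 2 * (1 + eta) <= 1.
    rewrite /tau; have := mulr_ge0 (ltW eta0) (sqr_ge0 eta).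
    have : 0 <= eta * (1 - eta) by rewrite mulr_ge0 ?ltW//; lra.
    have : 0 <= eta * (eta * (1 - eta)).
      by rewrite !mulr_ge0 ?ltW//; lra.
    by lra.
  have : tau ^+ 2 * (1 + eta) * e ^+ 2 <= 1 * e ^+ 2 by rewrite ler_wpM2r// sqr_ge0.
  move: d'k e1v; rewrite exprMn; lra.
pose u := e^-1 *: d.
have dE : d = e *: u by rewrite /u scalerA mulfV ?scale1r// gt_eqF.
have ud : `|u| <= C by rewrite /u normrZ normfV (gtr0_norm e0) ler_pdivrMl// mulrC.
have Qu : bform F u u <= 1 + 2 * (e1 * C ^+ 2).
  move: dk; rewrite ler_norml => /andP[dk _].
  have dCe : e1 * `|d| ^+ 2 <= e1 * (C ^+ 2 * e ^+ 2).
    by rewrite ler_pM2l// -exprMn ler_pXn2r// nnegrE.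
  have : bform F d d <= (1 + 2 * (e1 * C ^+ 2)) * e ^+ 2.
    by move: dCe dk kd; lra.
  rewrite dE bformZ mulrC ler_pM2r// exprn_gt0//.
have gu : inner g u <= - (tau * s) + e2 * (C + nv).
  have phid := mind _ Dd'.
  move: dphi d'phi; rewrite !ler_norml => /andP[dphi _] /andP[_ d'phi].
  have n1 : e2 * `|d| <= e2 * (C * e) by rewrite ler_pM2l.
  have n2 : e2 * `|d'| <= e2 * (nv * e) by rewrite ler_pM2l.
  have gd' : inner g d' = - (tau * s) * e.
    by rewrite innerZ gv mulrN mulNr mulrAC.
  have : inner g d <= (- (tau * s) + e2 * (C + nv)) * e.
    by move: phid dphi d'phi n1 n2 gd'; lra.
  by rewrite dE innerZ mulrC ler_pM2r.
apply: delW => /=.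
have Tu : T u by exact: TZ.
have gus : s^-1 * inner g u <= - tau + kap / 16.
  by rewrite ler_pdivrMl//; move: gu; rewrite e2k; lra.
have := cP _ (TB Tu Tv); rewrite (bformBB _ _ FT) bvv bv => cuv.
have : c * `|u - v| ^+ 2 < c * del ^+ 2.
  by rewrite -/kap; move: cuv Qu gus; rewrite /tau; lra.
by rewrite distrC ltr_pM2l// ltr_sqr ?nnegrE// ltW.
Unshelve. all: by end_near. Qed.

End DescentLimit.

(** * Derivatives of the divergence *)

Section LogDerivatives.
Context (R : realType) (V : normedModType R).
Variables (a b : V -> R) (x : V).
Hypotheses (da : differentiable a x) (a0 : 0 < a x).

Lemma differentiable_ln_comp : differentiable (fun t => ln (a t)) x.
Proof.
apply: (@differentiable_comp _ _ _ _ a (@ln R)) => //.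
by apply/derivable1_diffP; have [] := is_derive1_ln a0.
Qed.

Lemma is_derive_ln_comp u : is_derive x u (fun t => ln (a t)) ('D_u a x / a x).
Proof.
have dl : differentiable (@ln R) (a x).
  by apply/derivable1_diffP; have [] := is_derive1_ln a0.
apply: DeriveDef; first exact/diff_derivable/differentiable_ln_comp.
apply: (etrans (deriveE u differentiable_ln_comp)).
apply: (etrans (congr1 (fun h : V -> R => h u) (diff_comp da dl))) => /=.
rewrite -[X in 'd _ _ X]mulr1 -[_ * 1]/('d a x u *: (1 : R)) linearZ.
by have [_ lnE] := is_derive1_ln a0; rewrite -(deriveE _ dl) lnE -deriveE.
Qed.

Lemma is_derive_mul_ln_sub c u : differentiable b x ->
  is_derive x u (fun t => b t * (ln (a t) - c))
    ('D_u b x * (ln (a x) - c) + b x * ('D_u a x / a x)).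
Proof.
move=> db; have Hb : is_derive x u b ('D_u b x) by exact/derivableP/diff_derivable.
have Hl := is_deriveB (is_derive_ln_comp u) (is_derive_cst c x u).
have := is_deriveM Hb Hl; rewrite subr0 => H.
apply: is_derive_eq H _.
by rewrite /GRing.scale /= addrC mulrC.
Qed.

End LogDerivatives.

Section Model.
Context (R : realType) (m n : nat) (dX dY : measure_display).
Context (X : measurableType dX) (Y : measurableType dY).
Local Notation E := 'M[R]_(m, n).
Variables (Px : probability X R) (mu : {sigma_finite_measure set Y -> \bar R}).
Variables (p : Y -> Y -> R) (P : Y -> probability Y R) (f : X -> E -> Y).
Variables (Theta : E) (U : set E).
Let q (th : E) (w : X * Y) : R := p w.2 (f w.1 th).
Let nu := (Px \x mu)%E.
Let g (th : E) (w : X * Y) : R := q th w * (ln (q th w) - ln (q Theta w)).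
Hypothesis dens : conditional_density mu p P.
Hypotheses (oU : open U) (UT : U Theta).
Hypothesis q_gt0 : forall th w, U th -> 0 < q th w.
Hypothesis iq : interchange nu 2 U q.
Hypothesis ig : interchange nu 2 U g.
Hypothesis ih : interchange nu 1 U (fun th w => q th w * ln (q th w)).

(** A real-valued form of [mean_KL], over the product measure in which the regularity conditions are
    stated. *)
Definition mean_divergence (th : E) : R := \int[nu]_w g th w.
Local Notation K := mean_divergence.

Let density_prod (th : E) (h : X * Y -> R) : U th ->
  nu.-integrable setT (fun w => (h w * q th w)%:E) ->
  \int[Px]_x \int[P (f x th)]_y h (x, y) = \int[nu]_w (h w * q th w).
Proof.
move=> Uth; apply: (Rintegral_density_prod (P := fun x => P (f x th))) => //.
- by move=> w; exact: q_gt0.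
- by move=> x; have [] := dens (f x th).
- by move=> x; have [] := dens (f x th).
Qed.

(** Constancy of the total mass on [U] is what makes the integrals of the first and second
    derivatives of [q] vanish. *)
Let mass1 th : U th -> \int[nu]_w q th w = 1.
Proof.
move=> Uth; have := @density_prod th (fun=> 1) Uth.
rewrite (_ : (fun w => (1 * q th w)%:E) = (fun w => (q th w)%:E)); last first.
  by apply/funext => w; rewrite mul1r.
move=> /(_ (iq.1 _ Uth)) H.
transitivity (\int[nu]_w (1 * q th w)).
  by apply: eq_Rintegral => w _; rewrite mul1r.
rewrite -H; transitivity (\int[Px]_x (1 : R)).
  apply: eq_Rintegral => x _.
  rewrite Rintegral_cst// mul1r.
  exact: (congr1 fine (probability_setT (P (f x th)))).
by rewrite Rintegral_cst// mul1r; exact: (congr1 fine (probability_setT Px)).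
Qed.

Lemma mean_KL_divergence th : U th -> mean_KL Px mu p f th Theta = (K th)%:E.
Proof.
move=> Uth; have gi := ig.1 _ Uth.
rewrite /mean_divergence /Rintegral fineK; last exact: integrable_fin_num.
rewrite -integral12_prod_meas1//; apply: eq_integral => x _.
apply: eq_integral => y _; rewrite /g /q /=.
have p1 : 0 < p y (f x th) := q_gt0 (x, y) Uth.
have p2 : 0 < p y (f x Theta) := q_gt0 (x, y) UT.
by rewrite !gt_eqF// ln_div.
Qed.

(** The parameter enters both the sampling distribution and the log-likelihood, so [Phi] is an
    entropy and its derivative also acts on the distribution. *)
Lemma Phi_neg_entropy th : U th ->
  Phi Px p P f th = - \int[nu]_w (q th w * ln (q th w)).
Proof.
move=> Uth; rewrite /Phi; congr (- _).
transitivity (\int[nu]_w (ln (q th w) * q th w)); last first.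
  by apply: eq_Rintegral => w _; rewrite mulrC.
apply: (density_prod (h := fun w => ln (q th w))) => //.
rewrite (_ : (fun w => _) = (fun w => (q th w * ln (q th w))%:E)).
  exact: ih.1.
by apply/funext => w; rewrite mulrC.
Qed.

Let nearU : \forall th \near Theta, U th.
Proof. exact: open_nbhs_nbhs. Qed.

Lemma Phi_continuous th : U th -> {for th, continuous (Phi Px p P f)}.
Proof.
move=> Uth; have cI := ih.2.1 _ Uth.
apply: near_eq_continuous_at (continuousN cI).
apply: filterS (open_nbhs_nbhs (conj oU Uth)) => t Ut.
by rewrite Phi_neg_entropy.
Qed.

Lemma Phi_differentiable : differentiable (Phi Px p P f) Theta.
Proof.
have dI := ih.2.2.1 _ UT.
apply: near_eq_differentiable (differentiableN dI).
by apply: filterS nearU => t Ut; rewrite Phi_neg_entropy.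
Qed.

Lemma divergence_continuous th : U th -> {for th, continuous K}.
Proof. exact: ig.2.1. Qed.

Lemma divergence_differentiable th : U th -> differentiable K th.
Proof. exact: ig.2.2.1. Qed.

Lemma divergence0 : K Theta = 0.
Proof.
rewrite /mean_divergence (_ : g Theta = cst 0).
  by rewrite Rintegral_cst// mul0r.
by apply/funext => w; rewrite /g subrr mulr0.
Qed.

Let dq th w : U th -> differentiable (q ^~ w) th.
Proof. by move=> Uth; exact: (iq.2.2.2.1 th w Uth). Qed.

Let d2q u th w : U th -> differentiable (fun t => 'D_u (q ^~ w) t) th.
Proof. by move=> Uth; exact: ((iq.2.2.2.2 u).2.2.2.2.1 th w Uth). Qed.

Let Dg u th w : U th -> 'D_u (g ^~ w) th =
  'D_u (q ^~ w) th * (ln (q th w) - ln (q Theta w)) + 'D_u (q ^~ w) th.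
Proof.
move=> Uth.
have q0 : 0 < q th w by exact: q_gt0.
have [_ ->] := is_derive_mul_ln_sub (dq w Uth) q0 (ln (q Theta w)) u (dq w Uth).
by congr (_ + _); rewrite mulrCA mulfV ?mulr1// gt_eqF.
Qed.

(** At [Theta] the log-ratio vanishes, which removes the term with the second derivative of [q]
    times the logarithm. Of the two terms left, the second integrates to 0 and the first is the
    product of scores weighted by [q]. *)
Let D2g u v w : 'D_v (fun th => 'D_u (g ^~ w) th) Theta =
  'D_u (q ^~ w) Theta * 'D_v (q ^~ w) Theta / q Theta w +
  'D_v (fun th => 'D_u (q ^~ w) th) Theta.
Proof.
have q0 : 0 < q Theta w by exact: q_gt0.
pose b th := 'D_u (q ^~ w) th.
have H := is_derive_mul_ln_sub (dq w UT) q0 (ln (q Theta w)) v (d2q u w UT).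
have Hb : is_derive Theta v b ('D_v b Theta).
  exact/derivableP/diff_derivable/d2q.
have [_ HE] := is_deriveD H Hb.
rewrite (near_eq_derive (g := (fun t : E => 'D_u (q ^~ w) t *
    (ln (q t w) - ln (q Theta w))) + (fun t => 'D_u (q ^~ w) t))).
  by rewrite HE subrr mulr0 add0r mulrA.
by apply: filterS nearU => t Ut; rewrite Dg.
Qed.

Let int_Dq u th : U th -> \int[nu]_w 'D_u (q ^~ w) th = 0.
Proof.
move=> Uth; rewrite -(iq.2.2.2.2 u).1//.
rewrite (near_eq_derive (g := cst (1 : R) : E -> R)) ?derive_cst//.
by apply: filterS (open_nbhs_nbhs (conj oU Uth)) => t Ut; rewrite mass1.
Qed.

Let int_D2q u v : \int[nu]_w 'D_v (fun th => 'D_u (q ^~ w) th) Theta = 0.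
Proof.
rewrite -((iq.2.2.2.2 u).2.2.2.2.2 v).1//.
rewrite (near_eq_derive (g := cst (0 : R) : E -> R)) ?derive_cst//.
by apply: filterS nearU => t Ut; rewrite int_Dq.
Qed.

Let DK u : {near Theta, (fun th => \int[nu]_w 'D_u (g ^~ w) th) =1 'D_u K}.
Proof. by apply: filterS nearU => th Uth; rewrite (ig.2.2.2.2 u).1. Qed.

Lemma divergence_derive0 u : 'D_u K Theta = 0.
Proof.
rewrite -(nbhs_singleton (DK u)) -[RHS](int_Dq u UT).
by apply: eq_Rintegral => w _; rewrite Dg// subrr mulr0 add0r.
Qed.

Lemma divergence_differentiable2 u : differentiable ('D_u K) Theta.
Proof.
apply: near_eq_differentiable (DK u) _.
exact: (ig.2.2.2.2 u).2.2.2.1.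
Qed.

(** The regularity conditions give integrability of the second derivatives of [g] and of [q]; by
    [D2g] this function is their difference. *)
Let score_integrable u v : nu.-integrable setT (fun w =>
  ('D_u (q ^~ w) Theta * 'D_v (q ^~ w) Theta / q Theta w)%:E).
Proof.
have i1 := ((ig.2.2.2.2 u).2.2.2.2.2 v).2.1 _ UT.
have i2 := ((iq.2.2.2.2 u).2.2.2.2.2 v).2.1 _ UT.
have := integrableB measurableT i1 i2.
apply: eq_integrable => // w _.
by rewrite /= D2g -EFinB addrK.
Qed.

Lemma divergence_hessian u v : 'D_v ('D_u K) Theta =
  \int[nu]_w ('D_u (q ^~ w) Theta * 'D_v (q ^~ w) Theta / q Theta w).
Proof.
rewrite -(near_eq_derive v (DK u)) ((ig.2.2.2.2 u).2.2.2.2.2 v).1//.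
under eq_Rintegral do rewrite D2g.
have i1 := score_integrable u v.
have i2 := ((iq.2.2.2.2 u).2.2.2.2.2 v).2.1 _ UT.
by rewrite (RintegralD measurableT i1 i2) int_D2q addr0.
Qed.

(** Symmetry is read off the integral formula, not from a theorem on mixed partial derivatives. *)
Lemma divergence_hessianC u v : 'D_v ('D_u K) Theta = 'D_u ('D_v K) Theta.
Proof.
apply: (etrans (divergence_hessian u v)).
apply: (etrans _ (esym (divergence_hessian v u))); apply: eq_Rintegral => w _.
by rewrite [X in X / _]mulrC.
Qed.

Lemma score_covariance u v :
  \int[Px]_x \int[P (f x Theta)]_y
    ('D_u (loglik p f x y) Theta * 'D_v (loglik p f x y) Theta) =
  'D_v ('D_u K) Theta.
Proof.
pose h w := 'D_u (loglik p f w.1 w.2) Theta * 'D_v (loglik p f w.1 w.2) Theta.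
have hE w : h w * q Theta w =
    'D_u (q ^~ w) Theta * 'D_v (q ^~ w) Theta / q Theta w.
  have q0 : 0 < q Theta w by exact: q_gt0.
  have [_ Du] := is_derive_ln_comp (dq w UT) q0 u.
  have [_ Dv] := is_derive_ln_comp (dq w UT) q0 v.
  rewrite /h (_ : loglik p f w.1 w.2 = (fun t => ln (q t w)))// Du Dv.
  by field; rewrite gt_eqF.
apply: (etrans _ (esym (divergence_hessian u v))).
transitivity (\int[nu]_w (h w * q Theta w)); last first.
  by apply: eq_Rintegral => w _; rewrite hE.
apply: density_prod => //.
rewrite (_ : (fun w => _) = (fun w =>
  ('D_u (q ^~ w) Theta * 'D_v (q ^~ w) Theta / q Theta w)%:E))//.
by apply/funext => w; rewrite hE.
Qed.

Lemma loglik_differentiable x y : differentiable (loglik p f x y) Theta.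
Proof.
exact: (differentiable_ln_comp (dq (x, y) UT) (q_gt0 (x, y) UT)).
Qed.

End Model.

(** * Symmetric forms and second-order composition *)

Section SymmetricForm.
Context (R : realType) (m n : nat).
Local Notation E := 'M[R]_(m, n).
Variable H : E -> E -> R.
Hypothesis HC : forall u v, H u v = H v u.
Hypothesis HL : forall u a v w, H u (a *: v + w) = a * H u v + H u w.

Lemma form_sum (I : finType) u (a : I -> R) (v : I -> E) :
  H u (\sum_k a k *: v k) = \sum_k a k * H u (v k).
Proof.
elim/big_rec2: _ => [|k y1 y2 _ IH]; last by rewrite HL IH.
by have := HL u 1 0 0; rewrite scale1r addr0 mul1r => /eqP; rewrite -subr_eq subrr => /eqP.
Qed.

Lemma formB u v w : H u (v - w) = H u v - H u w.
Proof. by rewrite addrC -scaleN1r HL mulN1r addrC. Qed.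

Lemma form_bounded : exists2 C : R, 0 <= C & forall u v, `|H u v| <= C * `|u| * `|v|.
Proof.
have bnd u v : `|H u v| <= (\sum_i \sum_j `|H u (delta_mx i j)|) * `|v|.
  rewrite [v in leLHS]matrix_sum_delta pair_bigA /= form_sum.
  rewrite pair_bigA /= mulr_suml.
  apply: le_trans (ler_norm_sum _ _ _) _; apply: ler_sum => -[i j] _ /=.
  by rewrite normrM mulrC ler_wpM2l// mx_norm_ge.
exists (\sum_i \sum_j \sum_k \sum_l `|H (delta_mx i j) (delta_mx k l)|).
  by do 4 (apply: sumr_ge0 => ? _).
move=> u v; apply: le_trans (bnd u v) _; rewrite ler_wpM2r// mulr_suml.
apply: ler_sum => i _; rewrite mulr_suml; apply: ler_sum => j _.
by rewrite HC; exact: bnd.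
Qed.

Variables (T : set E) (Pi : 'M[R]_(m * n)).
Hypotheses (PiT : Pi^T = Pi) (Pi_id : forall A, T A -> Pi *m vec A = vec A).
Hypothesis Pi_im : forall v, exists2 A : E, T A & vec A = Pi *m v.

(** The projected coordinate vectors: a spanning family of [T], in general not free. The [i]-th
    coordinate of a Riemannian gradient is the derivative along [proj_basis i], which is why the
    Fisher matrix is a Gram matrix on this family. *)
Definition proj_basis (i : 'I_(m * n)) : E := vec_mx (row i Pi).
Definition proj_gram : 'M[R]_(m * n) := \matrix_(i, j) H (proj_basis i) (proj_basis j).

Lemma proj_basis_sum (c : 'rV[R]_(m * n)) :
  \sum_k c 0 k *: proj_basis k = vec_mx (c *m Pi).
Proof.
by rewrite mulmx_sum_row linear_sum; apply: eq_bigr => k _; rewrite linearZ.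
Qed.

Lemma proj_gramT : proj_gram^T = proj_gram.
Proof. by apply/matrixP => i j; rewrite !mxE HC. Qed.

Lemma proj_gram_range : Pi *m proj_gram = proj_gram.
Proof.
apply/matrixP => i j; rewrite mxE [RHS]mxE HC.
have -> : proj_basis i = \sum_k row i Pi 0 k *: proj_basis k.
  by rewrite proj_basis_sum -row_mul (projector_idem Pi_id Pi_im).
by rewrite form_sum; apply: eq_bigr => k _; rewrite !mxE HC.
Qed.

Lemma bform_proj_gram A : T A -> bform proj_gram A A = H A A.
Proof.
move=> TA; have AE : A = \sum_k (vec A)^T 0 k *: proj_basis k.
  by rewrite proj_basis_sum -{1}[Pi]PiT -trmx_mul Pi_id// /vec trmxK mxvecK.
rewrite [in RHS]AE form_sum /bform mxE; apply: eq_bigr => j _.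
rewrite [LHS]mulrC [_^T 0 j in RHS]mxE; congr (_ * _).
rewrite -AE HC [A in RHS]AE form_sum mxE; apply: eq_bigr => i _.
by rewrite [proj_gram _ _]mxE HC.
Qed.

End SymmetricForm.

Section SecondOrderComposition.
Context (R : realType) (m n : nat).
Local Notation E := 'M[R]_(m, n).

(** [K] has no first-order term at [x], so an error [o(|d|)] in [rho d - x = d + o(|d|)] changes [K]
    by [o(|d|^2)] only. *)
Lemma second_order_comp (H : E -> E -> R) (K : E -> R) (rho : E -> E) (x : E)
    (T : set E) (e : R) :
  (forall u v, H u v = H v u) ->
  (forall u a v w, H u (a *: v + w) = a * H u v + H u w) ->
  (forall e : R, 0 < e -> \forall h \near (0 : E),
     `|K (x + h) - H h h / 2| <= e * `|h| ^+ 2) ->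
  rho 0 = x -> differentiable rho 0 -> (forall d, T d -> 'D_d rho 0 = d) ->
  0 < e -> \forall d \near (0 : E), T d ->
    `|K (rho d) - H d d / 2| <= e * `|d| ^+ 2.
Proof.
move=> HC HL KE rho0 drho Drho e0.
have [C C0 CP] := form_bounded HC HL.
(* [e3 <= 1] gives [|h| <= 2 * |d|]. The change of [H] is then at most
   [3 * C * e3 * |d|^2 <= e * |d|^2], of which half counts; the other half of [e] is [4 * (e / 8)],
   from the expansion of [K] at [h]. *)
pose e3 := Num.min 1 (e / (3 * (C + 1))).
have C10 : 0 < 3 * (C + 1) by rewrite mulr_gt0// ltr_wpDl.
have e30 : 0 < e3 by rewrite lt_min ltr01 divr_gt0.
have e31 : e3 <= 1 by rewrite ge_min lexx.
have e3C : 3 * (C * e3) <= e.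
  have : e3 <= e / (3 * (C + 1)) by rewrite ge_min lexx orbT.
  by rewrite ler_pdivlMr//; lra.
have near1 := diff_near drho e30.
have near2 : \forall d \near (0 : E),
    `|K (x + (rho d - x)) - H (rho d - x) (rho d - x) / 2| <= e / 8 * `|rho d - x| ^+ 2.
  have c1 := continuousB (differentiable_continuous drho) (@cst_continuous E E x 0).
  have := KE _ (divr_gt0 e0 (ltr0n R 8)).
  by rewrite -{1}(subrr x) -{1}rho0 => /c1.
apply: filterS2 near1 near2 => d; rewrite add0r rho0 => + + Td.
rewrite (Drho _ Td) [x + _]addrC subrK; move: (rho d - x) => h hd Kh.
have hn : `|h| <= 2 * `|d|.
  have : `|h| <= `|h - d| + `|d| by rewrite -{1}(subrK d h) ler_normD.
  have : e3 * `|d| <= 1 * `|d| by rewrite ler_wpM2r.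
  by move: hd; lra.
have Hh : `|H h h - H d d| <= C * (e3 * `|d|) * (3 * `|d|).
  have -> : H h h - H d d = H h (h - d) + H d (h - d).
    by rewrite !(formB HL) [H d h]HC; ring.
  apply: le_trans (ler_normD _ _) _.
  apply: (@le_trans _ _ (C * `|h| * `|h - d| + C * `|d| * `|h - d|)).
    by apply: lerD; exact: CP.
  rewrite -mulrDl -mulrDr -mulrA -[leRHS]mulrA ler_wpM2l// [leRHS]mulrC.
  by apply: ler_pM => //; move: hn; lra.
have hn2 : `|h| ^+ 2 <= 4 * `|d| ^+ 2.
  have -> : 4 * `|d| ^+ 2 = (2 * `|d|) ^+ 2 by rewrite exprMn -natrX.
  by rewrite ler_sqr ?nnegrE// mulr_ge0.
have Hh2 : C * (e3 * `|d|) * (3 * `|d|) <= e * `|d| ^+ 2.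
  have -> : C * (e3 * `|d|) * (3 * `|d|) = 3 * (C * e3) * `|d| ^+ 2 by ring.
  by rewrite ler_wpM2r// sqr_ge0.
have hn3 : e / 8 * `|h| ^+ 2 <= e / 8 * (4 * `|d| ^+ 2) by rewrite ler_wpM2l// divr_ge0// ltW.
move: Kh Hh; rewrite !ler_norml => /andP[K1 K2] /andP[H1 H2].
apply/andP; split; lra.
Qed.

End SecondOrderComposition.

(** * The steepest descent direction *)

(** Smoothness on the tangent bundle provides a smooth map on an open set of pairs; freezing its
    base point gives [rho]. Its derivative at 0 is determined by the retraction along tangent lines,
    where [rho] and [Rt Theta] agree. *)
Lemma retraction_local_extension (R : realType) (m n : nat) (M : set 'M[R]_(m, n))
    (Rt : 'M[R]_(m, n) -> 'M[R]_(m, n) -> 'M[R]_(m, n)) (Theta : 'M[R]_(m, n)) :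
  retraction M Rt -> M Theta -> tangent M Theta 0 ->
  exists rho : 'M[R]_(m, n) -> 'M[R]_(m, n),
    [/\ rho 0 = Theta,
        \forall d \near (0 : 'M[R]_(m, n)), differentiable rho d,
        forall xi, tangent M Theta xi ->
          (forall a, tangent M Theta (a *: xi)) -> 'D_xi rho 0 = xi &
        \forall d \near (0 : 'M[R]_(m, n)), tangent M Theta d -> Rt Theta d = rho d].
Proof.
move=> [sR _ R0 DR] MT T0.
have [W [g [oW W0 sg gE]]] := sR (Theta, 0) (conj MT T0).
have dpair d : differentiable (fun d : 'M[R]_(m, n) => (Theta, d)) d.
  by apply: differentiable_pair.
have nearW : \forall d \near (0 : 'M[R]_(m, n)), W (Theta, d).
  have := differentiable_continuous (dpair 0); apply.
  exact: open_nbhs_nbhs.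
have gRt : \forall d \near (0 : 'M[R]_(m, n)), tangent M Theta d ->
    Rt Theta d = g (Theta, d).
  by apply: filterS nearW => d Wd Td; rewrite gE.
exists (fun d => g (Theta, d)); split => //.
- by rewrite -(nbhs_singleton gRt T0) R0.
- apply: filterS nearW => d Wd.
  by apply: (differentiable_comp (dpair d)); exact: (sg 1).1.
- move=> xi Txi TZ; have [_ DE] := DR _ _ MT Txi.
  have dg : differentiable (fun d => g (Theta, d)) 0.
    apply: (differentiable_comp (dpair 0)); exact: (sg 1).1.
  have := @is_derive_line _ _ _ _ 0 xi (0 : R).
  rewrite scale0r addr0 => /(_ _ _ dg)[_ <-].
  rewrite -[RHS]DE; apply/esym/near_eq_derive.
  have cl : {for (0 : R), continuous (fun t : R => t *: xi)}.
    exact: scalel_continuous.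
  have gRt' : \forall t \near (0 : R), tangent M Theta (t *: xi) ->
      Rt Theta (t *: xi) = g (Theta, t *: xi).
    have := cl [set d | tangent M Theta d -> Rt Theta d = g (Theta, d)].
    by rewrite scale0r => /(_ gRt).
  by apply: filterS gRt' => t Rg; rewrite add0r; exact: Rg.
Qed.

Lemma fisher_proj_gram (R : realType) (m n : nat)
  (dX dY : measure_display) (X : measurableType dX) (Y : measurableType dY)
  (Px : probability X R)
  (p : Y -> Y -> R) (P : Y -> probability Y R)
  (f : X -> 'M[R]_(m, n) -> Y) (M : set 'M[R]_(m, n)) (Theta : 'M[R]_(m, n))
  (Pi : 'M[R]_(m * n)) (H : 'M[R]_(m, n) -> 'M[R]_(m, n) -> R) :
  Pi^T = Pi -> (forall A, tangent M Theta A -> Pi *m vec A = vec A) ->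
  (forall v, exists2 A, tangent M Theta A & vec A = Pi *m v) ->
  (forall x y, differentiable (loglik p f x y) Theta) ->
  (forall u v, \int[Px]_x \int[P (f x Theta)]_y
    ('D_u (loglik p f x y) Theta * 'D_v (loglik p f x y) Theta) = H u v) ->
  fisher Px p P f M Theta = proj_gram H Pi.
Proof.
move=> PiT Pi_id Pi_im dl HE; apply/matrixP => i j; rewrite [LHS]mxE [RHS]mxE -HE.
apply: eq_Rintegral => x _; apply: eq_Rintegral => y _.
have rE k : vec (rgrad M (loglik p f x y) Theta) k 0 =
    'D_(proj_basis Pi k) (loglik p f x y) Theta.
  have [_ ->] := orth_projE PiT Pi_id Pi_im (egrad (loglik p f x y) Theta).
  rewrite derive_egrad// innerC /inner {2}/vec vec_mxK trmxK.
  by rewrite -row_mul [RHS]mxE.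
have outerE (w : 'cV[R]_(m * n)) : (w *m w^T) i j = w i 0 * w j 0.
  by rewrite mxE big_ord1 [w^T _ _]mxE.
by rewrite outerE !rE.
Qed.

(** A small divergence need not force a small direction, since a remote point of [M] may carry the
    same conditional distributions. The limit is therefore proved for candidates near 0, and for all
    candidates when the feasible sets shrink to 0. *)
Theorem theorem3p1 (R : realType) (m n : nat)
  (dX dY : measure_display) (X : measurableType dX) (Y : measurableType dY)
  (Px : probability X R) (mu : {sigma_finite_measure set Y -> \bar R})
  (p : Y -> Y -> R) (P : Y -> probability Y R)
  (f : X -> 'M[R]_(m, n) -> Y)
  (dimM : nat) (M : set 'M[R]_(m, n))
  (Rt : 'M[R]_(m, n) -> 'M[R]_(m, n) -> 'M[R]_(m, n))
  (Theta : 'M[R]_(m, n)) :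
  conditional_density mu p P ->
  embedded_submanifold dimM M ->
  second_order_retraction M Rt ->
  M Theta ->
  regular_model Px mu p f Theta ->
  posdef_on (tangent M Theta) (fisher Px p P f M Theta) ->
  rgrad M (Phi Px p P f) Theta != 0 ->
  let limit_direction : 'M[R]_(m, n) :=
    (dual_norm Px p P f M Theta)^-1 *:
      - natural_direction Px p P f M Theta in
  (exists2 N0 : set 'M[R]_(m, n), nbhs (0 : 'M[R]_(m, n)) N0 &
     forall N : set 'M[R]_(m, n), nbhs (0 : 'M[R]_(m, n)) N -> N `<=` N0 ->
       rescaled_limit (descent_steps Px mu p P f M Rt Theta N)
         limit_direction) /\
  ((forall N : set 'M[R]_(m, n), nbhs (0 : 'M[R]_(m, n)) N ->
      \forall e \near (0 : R)^'+,
        feasible Px mu p f M Rt Theta setT e `<=` N) ->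
   rescaled_limit (descent_steps Px mu p P f M Rt Theta setT)
     limit_direction).
Proof.
move=> dens Msub [retR _] MT [U [[oU UT q_gt0] [iq ig ih]]] Fpos g0 v.
have [W TW] := tangent_vspace Msub MT.
have [Pi [PiT Pi_id0 Pi_im0]] := vspace_projector W.
have Pi_id A : tangent M Theta A -> Pi *m vec A = vec A.
  by rewrite TW; exact: Pi_id0.
have Pi_im w : exists2 A, tangent M Theta A & vec A = Pi *m w.
  by rewrite TW; exact: Pi_im0.
have cT : closed (tangent M Theta) by rewrite TW; exact: vspace_closed.
have T0 : tangent M Theta 0 by rewrite TW; exact: mem0v.
have TZ a A : tangent M Theta A -> tangent M Theta (a *: A).
  by rewrite TW => AW; exact: memvZ.
have TB A B : tangent M Theta A -> tangent M Theta B -> tangent M Theta (A - B).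
  by rewrite TW => AW BW; exact: memvB.
pose K := mean_divergence Px mu p f Theta.
pose H (u w : 'M[R]_(m, n)) : R := 'D_w ('D_u K) Theta.
have d2K u : differentiable ('D_u K) Theta.
  exact: (divergence_differentiable2 oU UT ig).
have HC u w : H u w = H w u by exact: (divergence_hessianC dens oU UT q_gt0 iq ig).
have HL u a w z : H u (a *: w + z) = a * H u w + H u z.
  by rewrite /H !(deriveE _ (d2K u)) linearP.
have FE : fisher Px p P f M Theta = proj_gram H Pi.
  apply: (fisher_proj_gram PiT Pi_id Pi_im).
    exact: (loglik_differentiable UT q_gt0 iq).
  exact: (score_covariance dens oU UT q_gt0 iq ig).
set F := fisher Px p P f M Theta in Fpos FE.
have FT : F^T = F by rewrite FE proj_gramT.
have PiF : Pi *m F = F.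
  by rewrite FE; exact: (proj_gram_range HC HL Pi_id Pi_im).
have bF A : tangent M Theta A -> bform F A A = H A A.
  by move=> TA; rewrite FE; exact: (bform_proj_gram HC HL PiT Pi_id).
set g := rgrad M (Phi Px p P f) Theta in g0.
have [Tg gE] : tangent M Theta g /\ vec g = Pi *m vec (egrad (Phi Px p P f) Theta).
  exact: (orth_projE PiT Pi_id Pi_im).
pose nd := natural_direction Px p P f M Theta.
have [Tnd Fnd] : tangent M Theta nd /\ F *m vec nd = vec g.
  have [B TB' FB] := posdef_solve Pi_id Pi_im PiF Tg Fpos.
  exact: (@xgetI _ 0 [set B | tangent M Theta B /\ F *m vec B = vec g] B
    (conj TB' FB)).
pose s := dual_norm Px p P f M Theta.
(* Through [F nd = g] this number is [nd^T F nd], and [nd] is nonzero because [g] is. *)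
have gnd : 0 < inner g nd.
  have nd0 : nd != 0.
    by apply: contra_neq g0 => nd0; apply: vec_inj; rewrite -Fnd nd0 !vec0 mulmx0.
  by have := Fpos _ Tnd nd0; rewrite -mulmxA Fnd innerC.
have s0 : 0 < s by rewrite /s /dual_norm sqrtr_gt0.
have s2 : s ^+ 2 = inner g nd by rewrite /s /dual_norm sqr_sqrtr// ltW.
have Tv : tangent M Theta v by rewrite /v -scaleN1r; exact/TZ/TZ.
have Fv : F *m vec v = - s^-1 *: vec g.
  by rewrite /v vecZ vecN -scalemxAr mulmxN Fnd scalerN scaleNr.
have gv : inner g v = - s.
  rewrite /inner /v vecZ vecN -scalemxAr mulmxN -/nd -/s mxE mxE.
  rewrite -[X in - X]/(inner g nd) -s2 mulrN expr2 mulKf// gt_eqF//.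
have [rho [rho0 drho Drho Rtrho]] := retraction_local_extension retR MT T0.
have drho0 := nbhs_singleton drho.
have rhoU : \forall d \near (0 : 'M[R]_(m, n)), U (rho d).
  apply: (differentiable_continuous drho0).
  by rewrite rho0; exact: open_nbhs_nbhs.
have DrhoT d : tangent M Theta d -> 'D_d rho 0 = d.
  by move=> Td; apply: Drho => // a; exact: TZ.
have [r0 r00 r0P] := near0_norm (filterI drho (filterI rhoU Rtrho)).
have kC d : `|d| < r0 -> {for d, continuous (K \o rho)}.
  move=> /r0P[dd [Ud _]]; apply: continuous_comp.
    exact: differentiable_continuous.
  exact: (divergence_continuous ig).
have phiC d : `|d| < r0 -> {for d, continuous (Phi Px p P f \o rho)}.
  move=> /r0P[dd [Ud _]]; apply: continuous_comp.
    exact: differentiable_continuous.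
  exact: (Phi_continuous dens oU q_gt0 ih).
have kE (e : R) : 0 < e -> \forall d \near (0 : 'M[R]_(m, n)),
    tangent M Theta d -> `|(K \o rho) d - bform F d d / 2| <= e * `|d| ^+ 2.
  move=> e0.
  have KE (e' : R) : 0 < e' -> \forall h \near (0 : 'M[R]_(m, n)),
      `|K (Theta + h) - H h h / 2| <= e' * `|h| ^+ 2.
    move=> e'0.
    have := taylor2 oU UT (divergence_differentiable ig) d2K
      (divergence_derive0 dens oU UT q_gt0 iq ig) e'0.
    by apply: filterS => h; rewrite divergence0 subr0.
  have := second_order_comp HC HL KE rho0 drho0 DrhoT e0.
  by apply: filterS => d dP Td; rewrite bF//; exact: dP.
have phiE (e : R) : 0 < e -> \forall d \near (0 : 'M[R]_(m, n)),
    tangent M Theta d ->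
    `|(Phi Px p P f \o rho) d - (Phi Px p P f \o rho) 0 - inner g d| <= e * `|d|.
  move=> e0.
  have dPhi : differentiable (Phi Px p P f) (rho 0).
    by rewrite rho0; exact: (Phi_differentiable dens oU UT q_gt0 ih).
  have dc := differentiable_comp drho0 dPhi.
  have := diff_near dc e0; apply: filterS => d + Td; rewrite add0r.
  (* Along tangent [d] the Euclidean gradient can be replaced by its projection [g], since [Pi] is
     symmetric and fixes [vec d]. *)
  have -> : 'D_d (Phi Px p P f \o rho) 0 = inner g d; last by [].
  apply: (etrans (deriveE d dc)).
  apply: (etrans (congr1 (fun h : 'M[R]_(m, n) -> R => h d) (diff_comp drho0 dPhi))).
  rewrite /= -(deriveE d drho0) DrhoT// -(deriveE d dPhi) derive_egrad// rho0.
  by rewrite /inner gE trmx_mul PiT -mulmxA Pi_id.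
have [r1 r10 r1P] := descent_limit cT T0 TZ TB FT Fpos s0 Tv Fv gv r00 kC phiC kE phiE.
pose r := Num.min r0 r1.
have r_gt0 : 0 < r by rewrite lt_min r00.
pose N0 := [set d : 'M[R]_(m, n) | `|d| < r].
have nN0 : nbhs (0 : 'M[R]_(m, n)) N0.
  apply: (nbhs_normP (0 : 'M[R]_(m, n)) N0).2; exists r => //= d.
  by rewrite /= sub0r normrN.
have main N : nbhs (0 : 'M[R]_(m, n)) N -> N `<=` N0 ->
    rescaled_limit (descent_steps Px mu p P f M Rt Theta N) v.
  move=> nN NN0.
  have NrP d : N d -> `|d| < r0 /\ `|d| < r1.
    by move=> /NN0; rewrite /N0 /= lt_min => /andP[].
  have := r1P N nN (fun d Nd => (NrP d Nd).2).
  set A := (fun e => argmin _ _); set B := descent_steps _ _ _ _ _ _ _ _ _.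
  suff -> : A = B by [].
  apply/funext => e; rewrite /A /B /descent_steps.
  have RtE d : N d -> tangent M Theta d -> Rt Theta d = rho d /\ U (rho d).
    by move=> /NrP[/r0P[_ [Ud RtE]] _] Td; split => //; exact: RtE.
  have -> : feasible Px mu p f M Rt Theta N e =
      [set d | [/\ N d, tangent M Theta d & (K \o rho) d <= e ^+ 2 / 2]].
    apply/seteqP; split=> d [Nd Td kd]; split => //; have [RE Ud] := RtE _ Nd Td.
      by move: kd; rewrite RE (mean_KL_divergence UT q_gt0 ig Ud) lee_fin.
    by rewrite RE (mean_KL_divergence UT q_gt0 ig Ud) lee_fin.
  apply/seteqP; split=> d [Dd mind]; split => // d' Dd'; have := mind d' Dd';
    case: Dd => Nd Td _; case: Dd' => Nd' Td' _;
    by rewrite (RtE _ Nd Td).1 (RtE _ Nd' Td').1.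
split; first by exists N0.
move=> feasN; have [ne lim] := main N0 nN0 (@subset_refl _ N0).
(* Once the feasible set lies in [N0], restricting to [N0] leaves it unchanged, hence also its
   minimisers. *)
have stepsE : \forall e \near (0 : R)^'+,
    descent_steps Px mu p P f M Rt Theta setT e =
    descent_steps Px mu p P f M Rt Theta N0 e.
  apply: filterS (feasN N0 nN0) => e fN; rewrite /descent_steps; congr argmin.
  apply/seteqP; split=> d; last by move=> [_ Td kd].
  by move=> Dd; have [_ Td kd] := Dd; split => //; exact: fN.
split; first by apply: filterS2 ne stepsE => e + ->.
by move=> W' /lim; apply: filterS2 stepsE => e -> .
Qed.
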